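(* Let $n$ and $m$ be positive integers. The number of rhombus tilings of the hexagon $H(2n+1,2m-1)$ with side lengths $2n+1,2m-1,2n+1,2n+1,2m-1,2n+1$ which contain the rhombus above and next to the rhombus which is adjacent to (and above) the center of the hexagon (that is, the axis rhombus $\rho_l$ with $l=n+m+1$) equals \begin{multline*} \frac{\binom{2m-1}{m}\binom{n+m-1}{m-1}\binom{2n+2}{n-1}\binom{2n+m}{n+1}}{(m+1)(m+2)(2n-3)(n+m-1)(n+m+1)\binom{2n+m}{m+2}\binom{4n+2m}{2n+m}}\\ \times\Biggl(\frac{(n+2)(n+3)(2n-1)(2n-3)Y(m,n)}{(n+m-1)(n+m)^2(n+m+1)} -\frac{24(m-1)n(2n+m+1)(2n+3)}{(n+m-2)(n+m+2)}\\ \cdot\sum_{h=0}^{n-1}\frac{(4)_h\,(1-n)_h\,(\frac52+n)_h\,(2-n-m)_h\,(2+n+m)_h}{(1)_h\,(4+n)_h\,(\frac52-n)_h\,(3+n+m)_h\,(3-n-m)_h}\Biggr) \prod_{i=1}^{2n+1}\prod_{j=1}^{2m-1}\prod_{k=1}^{2n+1}\frac{i+j+k-1}{i+j+k-2}, \end{multline*} where \begin{multline*} Y(m,n)= 1 - 2 m^2 + m^4 + 5 n - 4 m n - 2 m^2 n + 4 m^3 n - 3 m^4 n + 22 n^2 - 4 m n^2 - 4 m^2 n^2 \\ - 12 m^3 n^2 - 2 m^4 n^2 + 50 n^3 - 16 m n^3 - 26 m^2 n^3 - 8 m^3 n^3 + 39 n^4 - 28 m n^4 - 12 m^2 n^4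 + 5 n^5 - 8 m n^5 - 2 n^6. \end{multline*}
   Context: Shifted factorial: $(a)_0:=1$ and $(a)_k:=a(a+1)\cdots(a+k-1)$ for $k\ge1$. Singular expressions are to be read as the appropriate limit; here this concerns only $m=1$, where the expression in large parentheses is the limit as the real variable $m$ tends to $1$ with $n$ fixed (the factor $m-1$ cancels against a vanishing denominator factor $(3-n-m)_{n-1}$ in the term $h=n-1$, or against $n+m-2$ if $n=1$). Hexagon: $H(N,M)$ is the hexagon with all angles $120^\circ$ and side lengths, in cyclic order, $N,M,N,N,M,N$, placed with vertices $(0,0)$, $(\pm\frac{\sqrt3}{2}N,\frac N2)$, $(\pm\frac{\sqrt3}{2}N,\frac N2+M)$, $(0,N+M)$ (the sides of length $M$ are vertical). It is subdivided into unit equilateral triangles by the triangular lattice generated by $(0,1)$ and $(\frac{\sqrt3}2,\frac12)$. A rhombus is the union of two unit lattice triangles sharing an edge (side lengths 1, angles $60^\circ$ and $120^\circ$); a rhombus tiling of $H(N,M)$ is a covering of $H(N,M)$ by such rhombi without overlaps. Axis rhombi: for $0\le l\le N+M-1$, $\rho_l$ is the rhombus with vertices $(0,l)$, $(0,l+1)$, $(\pm\frac{\sqrt3}{2},l+\frac12)$; these are the rhombi symmetric about the vertical symmetry axis (of length $N+M$). The center of the hexagon is $(0,\frac{N+M}2)$. *)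

(* Defs.v *)
From HB Require Import structures.
From mathcomp Require Import all_boot all_order all_algebra finmap.
From mathcomp Require Import zify.
From mathcomp Require Import all_classical all_reals all_analysis.

Set Implicit Arguments.
Unset Strict Implicit.
Unset Printing Implicit Defensive.

Import Order.TTheory GRing.Theory Num.Theory.
Import numFieldNormedType.Exports.

Local Open Scope fset_scope.
Local Open Scope ring_scope.

(* The point a * (sqrt 3 / 2, 1 / 2) + b * (0, 1) of the triangular lattice,
   with Cartesian coordinates x = a * sqrt 3 / 2 and y = a / 2 + b, is encoded
   by the pair (a, b). *)
Notation lattice_point := (int * int)%type.

(* Squared Euclidean distance; the two lattice generators have length 1 and
   scalar product 1 / 2. *)
Definition sqdist (p q : lattice_point) : int :=
  let da := q.1 - p.1 in let db := q.2 - p.2 in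
  da ^+ 2 + da * db + db ^+ 2.

(* H(N, M) = { (x, y) | |x| <= (sqrt 3 / 2) N and
                        |x| / sqrt 3 <= y <= N + M - |x| / sqrt 3 },
   where |x| / sqrt 3 = |a| / 2 and y = (a + 2 b) / 2. *)
Definition in_hexagon (N M : nat) (p : lattice_point) : bool :=
  (`|p.1| <= N%:Z) &&
  (`|p.1| <= p.1 + 2 * p.2 <= 2 * (N + M)%:Z - `|p.1|).

(* The enumeration range is no restriction: see mem_hexagon_points. *)
Definition hexagon_points (N M : nat) : {fset lattice_point} :=
  [fset p in [seq (i%:Z - N%:Z, j%:Z) : lattice_point
              | i <- iota 0 (2 * N).+1, j <- iota 0 (N + M).+1]
   | in_hexagon N M p].

Lemma mem_hexagon_points (N M : nat) (p : lattice_point) :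
  (p \in hexagon_points N M) = in_hexagon N M p.
Proof.
rewrite in_fset; apply: andb_idl; case: p => a b.
rewrite /in_hexagon -![(a, b).1]/a -![(a, b).2]/b => /andP[h1 /andP[h2 h3]].
have [i Hi ->] : exists2 i : nat, (i < (2 * N).+1)%N & a = i%:Z - N%:Z.
  by exists (absz (a + N%:Z)); lia.
have [j Hj ->] : exists2 j : nat, (j < (N + M).+1)%N & b = j%:Z.
  by exists (absz b); lia.
by apply/allpairsP; exists (i, j); rewrite !mem_iota.
Qed.

(* A lattice triangle is given by its set of vertices.  The hexagon being
   convex, it contains a triangle iff it contains the three vertices. *)
Definition unit_triangle (t : {fset lattice_point}) : bool :=
  (#|` t| == 3)%N && [forall p : t, forall q : t,
                        (p != q) ==> (sqdist (val p) (val q) == 1)].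

Definition hexagon_triangles (N M : nat) : {fset {fset lattice_point}} :=
  [fset t in fpowerset (hexagon_points N M) | unit_triangle t].

Definition share_edge (s t : {fset lattice_point}) : bool :=
  (#|` s `&` t| == 2)%N.

(* A rhombus is encoded by the set of the two triangles of which it is the
   union. *)
Definition hexagon_rhombi (N M : nat) : {fset {fset {fset lattice_point}}} :=
  [fset [fset s; t] | s in hexagon_triangles N M,
                      t in hexagon_triangles N M & share_edge s t].

(* Covering without overlaps: each triangle lies in exactly one rhombus. *)
Definition rhombus_tilings (N M : nat) :
    {fset {fset {fset {fset lattice_point}}}} :=
  [fset T in fpowerset (hexagon_rhombi N M)
   | [forall t : hexagon_triangles N M,
        #|` [fset r in T | val t \in (r : {fset _})]| == 1%N]].

(* The lattice points (0, l), (0, l + 1), (1, l), (-1, l + 1) are the points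
   (0, l), (0, l + 1), (sqrt 3 / 2, l + 1 / 2), (- sqrt 3 / 2, l + 1 / 2)
   of the plane. *)
Definition axis_rhombus (l : nat) : {fset {fset lattice_point}} :=
  let bottom : lattice_point := (0, l%:Z) in
  let top : lattice_point := (0, l%:Z + 1) in
  let right : lattice_point := (1, l%:Z) in
  let left : lattice_point := (-1, l%:Z + 1) in
  [fset [fset bottom; top; right]; [fset bottom; top; left]].

Definition num_tilings_containing (N M l : nat) : nat :=
  #|` [fset T in rhombus_tilings N M | axis_rhombus l \in (T : {fset _})]|.

Definition shifted_factorial (R : realType) (a : R) (k : nat) : R :=
  \prod_(0 <= i < k) (a + i%:R).

Definition Ypoly (R : realType) (m n : R) : R :=
  1 - 2 * m ^+ 2 + m ^+ 4 + 5 * n - 4 * m * n - 2 * m ^+ 2 * n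
  + 4 * m ^+ 3 * n - 3 * m ^+ 4 * n + 22 * n ^+ 2 - 4 * m * n ^+ 2
  - 4 * m ^+ 2 * n ^+ 2 - 12 * m ^+ 3 * n ^+ 2 - 2 * m ^+ 4 * n ^+ 2
  + 50 * n ^+ 3 - 16 * m * n ^+ 3 - 26 * m ^+ 2 * n ^+ 3
  - 8 * m ^+ 3 * n ^+ 3 + 39 * n ^+ 4 - 28 * m * n ^+ 4
  - 12 * m ^+ 2 * n ^+ 4 + 5 * n ^+ 5 - 8 * m * n ^+ 5 - 2 * n ^+ 6.

Definition hypergeometric_sum (R : realType) (n : nat) (x : R) : R :=
  let nu : R := n%:R in let sf := @shifted_factorial R in
  \sum_(0 <= h < n)
    (sf 4 h * sf (1 - nu) h * sf (5 / 2 + nu) h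
       * sf (2 - nu - x) h * sf (2 + nu + x) h)
    / (sf 1 h * sf (4 + nu) h * sf (5 / 2 - nu) h
       * sf (3 + nu + x) h * sf (3 - nu - x) h).

(* The factor containing Y(m, n) and the sum, with m replaced by a real x. *)
Definition parenthesis (R : realType) (n : nat) (x : R) : R :=
  let nu : R := n%:R in
  (nu + 2) * (nu + 3) * (2 * nu - 1) * (2 * nu - 3) * Ypoly x nu
    / ((nu + x - 1) * (nu + x) ^+ 2 * (nu + x + 1))
  - 24 * (x - 1) * nu * (2 * nu + x + 1) * (2 * nu + 3)
      / ((nu + x - 2) * (nu + x + 2))
    * hypergeometric_sum n x.

(* At m = 1 the expression is singular (for m >= 2 no denominator vanishes)
   and is read as its limit.  A relation is used since [lim] has a junk value
   in the absence of a limit. *)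
Definition parenthesis_value (R : realType) (n m : nat) (L : R) : Prop :=
  if m == 1%N then (parenthesis n x @[x --> (1 : R)^'] --> L)%classic
  else L = parenthesis n m%:R.

Definition prefactor (R : realType) (n m : nat) : R :=
  ('C(2 * m - 1, m) * 'C(n + m - 1, m - 1)
     * 'C(2 * n + 2, n - 1) * 'C(2 * n + m, n + 1))%N%:R
  / ((m%:R + 1) * (m%:R + 2) * (2 * n%:R - 3) * (n%:R + m%:R - 1)
     * (n%:R + m%:R + 1)
     * ('C(2 * n + m, m + 2) * 'C(4 * n + 2 * m, 2 * n + m))%N%:R).

Definition macmahon_product (R : realType) (n m : nat) : R :=
  \prod_(1 <= i < (2 * n + 1).+1) \prod_(1 <= j < (2 * m - 1).+1)
    \prod_(1 <= k < (2 * n + 1).+1)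
      (((i + j + k)%:R - 1) / ((i + j + k)%:R - 2)).

(* Main.v *)
Require Import Defs.
From HB Require Import structures.
From mathcomp Require Import all_boot all_order all_algebra all_fingroup finmap.
From mathcomp Require Import zify ring lra reals.

(** Cut a tiling of the hexagon along its vertical symmetry axis, and record the
    set X of axis rhombi it contains. On each side of the axis the sets of vertical
    rhombi met by successive vertical lines interlace, so that each half
    is a Gelfand-Tsetlin pattern with top row X, and the two halves can be filled in
    det(binomial(x_i, j))^2 ways. Hence the axis rhombi form the determinantal ensemble
    of the uniform weight on {0, ..., N+M-1}: by Cauchy-Binet, the number of tilings
    containing the l-th axis rhombus is MacMahon's product times the sum over
    k < N of t_k(l)^2 / <t_k, t_k>, with t_k the discrete Chebyshev polynomials.
    For N + M = 2 s and l = s + 1 the values t_k(l) have closed forms depending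
    on the parity of k. The sum over h in the theorem is then handled by creative
    telescoping in n, with s = n + m fixed: multiplied by a suitable scale, its summand
    changes by a Gosper-summable term when n is increased by one. *)

(** The one-point formula is reached through the complement: giving weight 0 to l and weight 1 to
    the other points selects the axis sets that avoid l, and turns the diagonal Gram matrix of the
    t_k into a diagonal matrix minus a rank-one matrix.

    MacMahon's formula is not presupposed. The total count is a product of squared norms, and its
    agreement with the triple product is proved by induction on M from M = 0, where the axis set is
    forced.

    With s = n + m fixed, the 2 s points and the evaluation point s + 1 do not depend on n; only the
    number 2 n + 1 of summed degrees does. A step in n thus adds exactly the degrees 2 n + 1 and 2 n
    + 2, and Y(m, n) is the rational part left beside the hypergeometric sum.

    The obstacle at m = 1 is that the last term reads 0 / 0. The vanishing factor is cancelled by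
    hand, and the resulting expression serves as L for every m: as the value itself for m >= 2, as
    the limit for m = 1. *)

Set Implicit Arguments.
Unset Strict Implicit.
Unset Printing Implicit Defensive.

Import Order.TTheory GRing.Theory Num.Theory.
Local Open Scope fset_scope.
Local Open Scope ring_scope.

(** * Lattice triangles and rhombi *)

Section LatticeTriangles.
Implicit Types (p q r : lattice_point) (s t : {fset lattice_point}).

(** [triL] has its vertical edge on the left, [triR] on the right; [triL p] and [triR p] share the
    slanted edge from (p.1, p.2 + 1) to (p.1 + 1, p.2). *)
Definition triL p : {fset lattice_point} := [fset p; (p.1, p.2 + 1); (p.1 + 1, p.2)].

Definition triR p : {fset lattice_point} :=
  [fset (p.1 + 1, p.2); (p.1 + 1, p.2 + 1); (p.1, p.2 + 1)].

Lemma mem_triL p q : (q \in triL p) =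
  [|| (q.1 == p.1) && (q.2 == p.2), (q.1 == p.1) && (q.2 == p.2 + 1)
    | (q.1 == p.1 + 1) && (q.2 == p.2)].
Proof. by case: p q => a b [c d]; rewrite !inE !xpair_eqE orbA. Qed.

Lemma mem_triR p q : (q \in triR p) =
  [|| (q.1 == p.1 + 1) && (q.2 == p.2), (q.1 == p.1 + 1) && (q.2 == p.2 + 1)
    | (q.1 == p.1) && (q.2 == p.2 + 1)].
Proof. by case: p q => a b [c d]; rewrite !inE !xpair_eqE orbA. Qed.

Lemma card_fset3I (K : choiceType) (x y z : K) (A : {fset K}) :
  x != y -> x != z -> y != z ->
  #|` [fset x; y; z] `&` A| = ((x \in A) + (y \in A) + (z \in A))%N.
Proof.
move=> xy xz yz.
pose l := [seq u <- [:: x; y; z] | u \in A].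
have /perm_size -> : perm_eq (enum_fset ([fset x; y; z] `&` A)) l.
  apply: uniq_perm; first exact: fset_uniq.
    by rewrite filter_uniq //= !inE negb_or xy xz yz.
  by move=> u; rewrite mem_filter !inE orbA andbC.
by rewrite size_filter /= addn0 addnA.
Qed.

Lemma card_fset3 (K : choiceType) (x y z : K) :
  x != y -> x != z -> y != z -> #|` [fset x; y; z]| = 3%N.
Proof.
move=> xy xz yz; rewrite -[[fset x; y; z]]fsetIid card_fset3I //.
by rewrite !inE !eqxx !orbT.
Qed.

Lemma triL_neq p : [/\ p != (p.1, p.2 + 1), p != (p.1 + 1, p.2)
                     & (p.1, p.2 + 1) != (p.1 + 1, p.2)].
Proof. by case: p => a b; split; rewrite xpair_eqE /=; lia. Qed.

Lemma triR_neq p : [/\ (p.1 + 1, p.2) != (p.1 + 1, p.2 + 1),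
  (p.1 + 1, p.2) != (p.1, p.2 + 1) & (p.1 + 1, p.2 + 1) != (p.1, p.2 + 1)].
Proof. by case: p => a b; split; rewrite xpair_eqE /=; lia. Qed.

Lemma card_triL p : #|` triL p| = 3%N.
Proof. by have [] := triL_neq p; exact: card_fset3. Qed.

Lemma card_triR p : #|` triR p| = 3%N.
Proof. by have [] := triR_neq p; exact: card_fset3. Qed.

Lemma triL_inj : injective triL.
Proof.
move=> [a b] [c d] /fsetP e; move: (e (a, b)) (e (c, d)).
by rewrite !mem_triL /= => e1 e2; congr (_, _); lia.
Qed.

Lemma triR_inj : injective triR.
Proof.
move=> [a b] [c d] /fsetP e; move: (e (a + 1, b)) (e (c + 1, d)) (e (a + 1,
  b + 1)) (e (c + 1, d + 1)).
by rewrite !mem_triR /= => e1 e2 e3 e4; congr (_, _); lia.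
Qed.

Lemma triLR p q : triL p != triR q.
Proof.
apply/eqP => e.
have : p \in triR q by rewrite -e mem_triL !eqxx.
have : (p.1, p.2 + 1) \in triR q by rewrite -e mem_triL !eqxx orbT.
have : (p.1 + 1, p.2) \in triR q by rewrite -e mem_triL !eqxx !orbT.
case: p q {e} => a b [c d]; rewrite !mem_triR /=.
case/or3P => /andP[/eqP e1 /eqP e2]; case/or3P => /andP[/eqP e3 /eqP e4]; lia.
Qed.

Lemma share_edgeLL p q : share_edge (triL p) (triL q) = false.
Proof.
have [h1 h2 h3] := triL_neq p; rewrite /share_edge card_fset3I // !mem_triL /=.
by case: p q {h1 h2 h3} => [a b] [c d] /=; lia.
Qed.

Lemma share_edgeRR p q : share_edge (triR p) (triR q) = false.
Proof.
have [h1 h2 h3] := triR_neq p; rewrite /share_edge card_fset3I // !mem_triR /=.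
by case: p q {h1 h2 h3} => [a b] [c d] /=; lia.
Qed.

(** The three cases are the upper slanted, the lower slanted and the vertical edge of [triL p]. *)
Definition adjacent p q : bool :=
  [|| (p.1 == q.1) && (p.2 == q.2), (p.1 == q.1) && (p.2 == q.2 + 1)
    | (p.1 == q.1 + 1) && (p.2 == q.2)].

Definition offR (x y : int) : bool :=
  [|| (x == 1) && (y == 0), (x == 1) && (y == 1) | (x == 0) && (y == 1)].

Lemma mem_triR_off p q : (q \in triR p) = offR (q.1 - p.1) (q.2 - p.2).
Proof. by rewrite mem_triR /offR !subr_eq !add0r ![1 + _]addrC. Qed.

Lemma share_edgeLR p q : share_edge (triL p) (triR q) = adjacent p q.
Proof.
have [h1 h2 h3] := triL_neq p; rewrite /share_edge card_fset3I //.
rewrite !mem_triR_off /=.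
have -> : adjacent p q = [|| (p.1 - q.1 == 0) && (p.2 - q.2 == 0),
    (p.1 - q.1 == 0) && (p.2 - q.2 == 1) | (p.1 - q.1 == 1) && (p.2 - q.2 == 0)].
  by rewrite /adjacent !subr_eq !add0r ![1 + _]addrC.
rewrite !(addrAC _ 1); move: (p.1 - q.1) (p.2 - q.2) => x y.
by case: x => [[|[|x]]|[|[|x]]]; case: y => [[|[|y]]|[|[|y]]].
Qed.

Lemma share_edgeC s t : share_edge s t = share_edge t s.
Proof. by rewrite /share_edge fsetIC. Qed.

Lemma sqdist_unit p q : sqdist p q = 1 ->
  exists da db : int, [/\ q = (p.1 + da, p.2 + db), da ^+ 2 + da * db + db ^+ 2 = 1,
     -1 <= da <= 1 & -1 <= db <= 1].
Proof.
have bound (x y : int) : x ^+ 2 + x * y + y ^+ 2 = 1 -> -1 <= x <= 1.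
  move=> e; have : 0 <= (x + 2 * y) ^+ 2 by exact: sqr_ge0.
  (* Completing the square gives 3 x^2 <= 4, hence |x| <= 1. *)
  have -> : (x + 2 * y) ^+ 2 = 4 * (x ^+ 2 + x * y + y ^+ 2) - 3 * (x * x) by ring.
  by rewrite e; move=> ?; have : x * x <= 1; [lia | nia].
case: p q => [a b] [c d]; rewrite /sqdist /= => e.
exists (c - a), (d - b); split; [by congr (_, _); lia | by [] | | ].
  exact: bound e.
by apply: (bound _ (c - a)); rewrite -[RHS]e; ring.
Qed.

Lemma sqdist_triL p : {in triL p &, forall q r, q != r -> sqdist q r = 1}.
Proof.
case: p => a b [c d] [e f]; rewrite !mem_triL xpair_eqE /sqdist /=.
by case/or3P => /andP[/eqP -> /eqP ->]; case/or3P => /andP[/eqP -> /eqP ->] h;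
  first [by rewrite !eqxx in h | ring].
Qed.

Lemma sqdist_triR p : {in triR p &, forall q r, q != r -> sqdist q r = 1}.
Proof.
case: p => a b [c d] [e f]; rewrite !mem_triR xpair_eqE /sqdist /=.
by case/or3P => /andP[/eqP -> /eqP ->]; case/or3P => /andP[/eqP -> /eqP ->] h;
  first [by rewrite !eqxx in h | ring].
Qed.

Definition offL (x y : int) : bool :=
  [|| (x == 0) && (y == 0), (x == 0) && (y == 1) | (x == 1) && (y == 0)].

Lemma mem_triL_off p q : (q \in triL p) = offL (q.1 - p.1) (q.2 - p.2).
Proof. by rewrite mem_triL /offL !subr_eq !add0r ![1 + _]addrC. Qed.

(** A finite check over 81 cases: seen from its first vertex, the triangle has vertices 0, (x, y),
    (z, w), and (u, v) is the offset of that first vertex from the anchor of the matching [triL] or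
    [triR]. *)
Lemma unit_offsets (x y z w : int) : -1 <= x <= 1 -> -1 <= y <= 1 ->
  -1 <= z <= 1 -> -1 <= w <= 1 -> x ^+ 2 + x * y + y ^+ 2 = 1 ->
  z ^+ 2 + z * w + w ^+ 2 = 1 ->
  (z - x) ^+ 2 + (z - x) * (w - y) + (w - y) ^+ 2 = 1 ->
  exists u v, [&& offL u v, offL (x + u) (y + v) & offL (z + u) (w + v)]
           || [&& offR u v, offR (x + u) (y + v) & offR (z + u) (w + v)].
Proof.
have cases (i : int) : -1 <= i <= 1 -> [\/ i = -1, i = 0 | i = 1].
  move=> ?; have : [|| i == -1, i == 0 | i == 1] by lia.
  by case/or3P => /eqP ->; [constructor 1 | constructor 2 | constructor 3].
move=> /cases[] -> /cases[] -> /cases[] -> /cases[] -> /eqP h1 /eqP h2 /eqP h3;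
first [by move: h1 | by move: h2 | by move: h3 | by exists 0, 0 | by exists 0,
  1 | by exists 1, 0 | by exists 1, 1].
Qed.

Lemma unit_distances p q r : sqdist p q = 1 -> sqdist p r = 1 -> sqdist q r = 1 ->
  exists o, [&& p \in triL o, q \in triL o & r \in triL o]
         || [&& p \in triR o, q \in triR o & r \in triR o].
Proof.
move=> /sqdist_unit[x [y [-> e1 x1 y1]]] /sqdist_unit[z [w [-> e2 z1 w1]]].
case: p => a b; rewrite /sqdist /= => e3.
have sub (i j k : int) : i + j - (i - k) = j + k by ring.
have subn (i k : int) : i - (i - k) = k by ring.
have e4 : (z - x) ^+ 2 + (z - x) * (w - y) + (w - y) ^+ 2 = 1 by rewrite -[RHS]e3; ring.
have [u [v uv]] := unit_offsets x1 y1 z1 w1 e1 e2 e4.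
exists (a - u, b - v); rewrite 3!mem_triL_off 3!mem_triR_off /=.
by rewrite (sub a x u) (sub a z u) (sub b y v) (sub b w v) (subn a u) (subn b v).
Qed.

Lemma unit_triangleP t : reflect (exists p, t = triL p \/ t = triR p) (unit_triangle t).
Proof.
apply: (iffP andP) => [[/eqP c3 /forallP H]|[p tE]].
  have dist : {in t &, forall p q, p != q -> sqdist p q = 1}.
    move=> p q pt qt pq; have /forallP/(_ [` qt])/implyP := H [` pt].
    by rewrite -val_eqE /= => /(_ pq)/eqP.
  have [p [q [r tE]]] : exists p q r, enum_fset t = [:: p; q; r].
    by case: (enum_fset t) c3 => [|p [|q [|r []]]] // _; exists p, q, r.
  have := fset_uniq t; rewrite tE /= !inE negb_or andbT => /andP[/andP[pq pr] qr].
  have mt x : (x \in t) = (x \in [:: p; q; r]) by rewrite -tE.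
  have pt : p \in t by rewrite mt !inE eqxx.
  have qt : q \in t by rewrite mt !inE eqxx orbT.
  have rt : r \in t by rewrite mt !inE eqxx !orbT.
  have [o ho] := unit_distances (dist _ _ pt qt pq) (dist _ _ pt rt pr) (dist _ _ qt rt
    qr).
  exists o; case/orP: ho => /and3P[po qo ro]; [left | right]; apply/eqP;
    rewrite eqEfcard c3 ?card_triL ?card_triR leqnn andbT; apply/fsubsetP => x;
    by rewrite mt !in_cons in_nil orbF => /or3P[] /eqP ->.
split; first by case: tE => ->; rewrite ?card_triL ?card_triR.
apply/forallP => x; apply/forallP => y; apply/implyP => xy; apply/eqP.
case: x y xy => [x xt] [y yt]; rewrite -val_eqE /=.
by case: tE xt yt => -> xt yt; [exact: (sqdist_triL xt yt) | exact: (sqdist_triR xt yt)].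
Qed.

End LatticeTriangles.

(** Naming the left triangle first makes the unordered pair comparable componentwise ([rhom_eq]).
    The lock keeps the nested finite sets folded. *)
HB.lock Definition rhom (p q : lattice_point) : {fset {fset lattice_point}} :=
  [fset triL p; triR q].

(** * Triangles and rhombi of the hexagon in coordinates adapted to the vertical strips *)

Section HexagonRhombi.
Variables N M : nat.
Implicit Types (p q : lattice_point) (t : {fset lattice_point}).
Implicit Types (r : {fset {fset lattice_point}}) (T : {fset {fset {fset lattice_point}}}).

Definition insideL p : bool :=
  [&& in_hexagon N M p, in_hexagon N M (p.1, p.2 + 1) & in_hexagon N M (p.1 + 1, p.2)].

Definition insideR p : bool :=
  [&& in_hexagon N M (p.1 + 1, p.2), in_hexagon N M (p.1 + 1, p.2 + 1)
    & in_hexagon N M (p.1, p.2 + 1)].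

Lemma triL_hexagon p : (triL p \in hexagon_triangles N M) = insideL p.
Proof.
rewrite in_fset inE fpowersetE /=.
have -> : unit_triangle (triL p) by apply/unit_triangleP; exists p; left.
by rewrite andbT !fsubUset !fsub1set !mem_hexagon_points -andbA.
Qed.

Lemma triR_hexagon p : (triR p \in hexagon_triangles N M) = insideR p.
Proof.
rewrite in_fset inE fpowersetE /=.
have -> : unit_triangle (triR p) by apply/unit_triangleP; exists p; right.
by rewrite andbT !fsubUset !fsub1set !mem_hexagon_points -andbA.
Qed.

Lemma hexagon_trianglesP t : t \in hexagon_triangles N M ->
  exists p, (t = triL p /\ insideL p) \/ (t = triR p /\ insideR p).
Proof.
move=> tH; have : unit_triangle t by move: tH; rewrite in_fset inE => /andP[].
case/unit_triangleP => p [tE|tE]; exists p; [left|right]; split => //.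
  by rewrite -triL_hexagon -tE.
by rewrite -triR_hexagon -tE.
Qed.

Lemma triL_rhom p p' q : (triL p \in rhom p' q) = (p == p').
Proof. by rewrite rhom.unlock in_fset2 (inj_eq triL_inj p p') (negPf (triLR p q)) orbF.
  Qed.

Lemma triR_rhom p q q' : (triR q \in rhom p q') = (q == q').
Proof. by rewrite rhom.unlock in_fset2 (inj_eq triR_inj q q') eq_sym (negPf (triLR p
  q)). Qed.

Lemma rhom_eq p q p' q' : (rhom p q == rhom p' q') = (p == p') && (q == q').
Proof.
apply/eqP/andP => [e|[/eqP -> /eqP ->] //]; split.
  by rewrite -(triL_rhom p p' q') -e triL_rhom.
by rewrite -(triR_rhom p' q q') -e triR_rhom.
Qed.

Lemma hexagon_rhombiP r : reflect
  (exists p q, [/\ r = rhom p q, insideL p, insideR q & adjacent p q])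
  (r \in hexagon_rhombi N M).
Proof.
apply: (iffP (imfset2P _ _ _ _ _)) => [[s sH [t]]|[p [q [-> pL qR pq]]]].
  rewrite inE /= => /andP[tH st] ->.
  have [p [[sE pL]|[sE pR]]] := hexagon_trianglesP sH;
  have [q [[tE qL]|[tE qR]]] := hexagon_trianglesP tH; move: st; rewrite sE tE.
  - by rewrite share_edgeLL.
  - by rewrite share_edgeLR => pq; exists p, q; rewrite rhom.unlock.
  - by rewrite share_edgeC share_edgeLR => pq; exists q, p; rewrite rhom.unlock fsetUC.
  - by rewrite share_edgeRR.
exists (triL p); first by rewrite /= triL_hexagon.
by exists (triR q); rewrite ?rhom.unlock // inE /= triR_hexagon qR share_edgeLR.
Qed.

Lemma rhom_hexagon p q :
  (rhom p q \in hexagon_rhombi N M) = [&& insideL p, insideR q & adjacent p q].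
Proof.
apply/hexagon_rhombiP/and3P => [[p' [q' [/eqP]]]|[pL qR pq]]; last by exists p, q.
by rewrite rhom_eq => /andP[/eqP <- /eqP <-].
Qed.

Lemma card_fset_count (K : choiceType) (A : {fset K}) (Q : pred K) (l : seq K) :
  uniq l -> (forall x, x \in A -> Q x = (x \in l)) -> 
  #|` [fset x in A | Q x]| = count (mem A) l.
Proof.
move=> ul H; rewrite -size_filter.
apply: perm_size; apply: uniq_perm; rewrite ?fset_uniq ?filter_uniq // => x.
rewrite mem_filter !inE /=; case xA: (x \in A) => //=; exact: H.
Qed.

Lemma incidenceL T p : T `<=` hexagon_rhombi N M ->
  #|` [fset r in T | triL p \in (r : {fset _})]|
  = ((rhom p p \in T) + ((rhom p (p.1, (p.2 - 1)%R) \in T)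
      + (rhom p ((p.1 - 1)%R, p.2) \in T)))%N.
Proof.
move=> /fsubsetP TH.
rewrite (@card_fset_count _ _ _ [:: rhom p p; rhom p (p.1, p.2 - 1);
  rhom p (p.1 - 1, p.2)]) /= ?addn0 //.
  rewrite !inE !rhom_eq eqxx /= !negb_or; case: p => a b; rewrite !xpair_eqE /=; lia.
move=> r /TH/hexagon_rhombiP[p' [q [-> _ _]]].
rewrite triL_rhom !inE !rhom_eq; case: eqVneq => [<-|pp]; last first.
  by [].
rewrite /adjacent; case: p q => a b [c d]; rewrite !xpair_eqE /=; lia.
Qed.

Lemma incidenceR T q : T `<=` hexagon_rhombi N M ->
  #|` [fset r in T | triR q \in (r : {fset _})]|
  = ((rhom q q \in T) + ((rhom (q.1, (q.2 + 1)%R) q \in T)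
      + (rhom ((q.1 + 1)%R, q.2) q \in T)))%N.
Proof.
move=> /fsubsetP TH.
rewrite (@card_fset_count _ _ _ [:: rhom q q; rhom (q.1, q.2 + 1) q;
  rhom (q.1 + 1, q.2) q]) /= ?addn0 //.
  rewrite !inE !rhom_eq eqxx /= !negb_or; case: q => a b; rewrite !xpair_eqE /=; lia.
move=> r /TH/hexagon_rhombiP[p [q' [-> _ _]]].
rewrite triR_rhom !inE !rhom_eq; case: eqVneq => [<-|pp]; last first.
  by rewrite !andbF.
rewrite /adjacent; case: p q => a b [c d]; rewrite !xpair_eqE /=; lia.
Qed.

(* The reflection (a, b) |-> (-a, a + b) exchanges the two halves of the hexagon. In the
   right half, [big_tri] has its vertical edge on the line a = k, [small_tri] has it on
   the line a = k + 1, and both lie between these lines; [lozV] is the rhombus whose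
   short diagonal is the e-th unit segment of the line a = k, while [lozU] and [lozD]
   join the e-th small triangle to the big ones below and above it. *)
Definition big_tri (right : bool) (k e : nat) :=
  if right then triL (k%:Z, e%:Z) else triR (- k%:Z - 1, e%:Z + k%:Z).

Definition small_tri (right : bool) (k e : nat) :=
  if right then triR (k%:Z, e%:Z) else triL (- k%:Z - 1, e%:Z + k%:Z + 1).

Definition lozV (right : bool) (k e : nat) :=
  if right then rhom (k%:Z, e%:Z) (k%:Z - 1, e%:Z)
  else rhom (- k%:Z, e%:Z + k%:Z) (- k%:Z - 1, e%:Z + k%:Z).

Definition lozU (right : bool) (k e : nat) :=
  if right then rhom (k%:Z, e%:Z) (k%:Z, e%:Z)
  else rhom (- k%:Z - 1, e%:Z + k%:Z + 1) (- k%:Z - 1, e%:Z + k%:Z).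

Definition lozD (right : bool) (k e : nat) :=
  if right then rhom (k%:Z, e%:Z + 1) (k%:Z, e%:Z)
  else rhom (- k%:Z - 1, e%:Z + k%:Z + 1) (- k%:Z - 1, e%:Z + k%:Z + 1).

(** The lower neighbour of the big triangle number 0 lies outside the hexagon, hence the term 0 in
    that case. *)
Lemma incidence_big T c k e : T `<=` hexagon_rhombi N M ->
  #|` [fset r in T | big_tri c k e \in (r : {fset _})]|
  = ((lozV c k e \in T) + (lozU c k e \in T)
     + (if e is e'.+1 then (lozD c k e' \in T) : nat else 0))%N.
Proof.
move=> TH; have TH' := fsubsetP TH; rewrite /big_tri /lozV /lozU /lozD.
case: c; [rewrite incidenceL //= | rewrite incidenceR //=].
  case: e => [|e].
    have -> : (rhom (k%:Z, 0%:Z) (k%:Z, 0%:Z - 1) \in T) = false.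
      by apply/negP => /TH'; rewrite rhom_hexagon /insideR /in_hexagon /=; lia.
    by rewrite addn0 add0n addnC.
  have -> : e.+1%:Z - 1 = e%:Z by lia.
  have -> : e.+1%:Z = e%:Z + 1 by lia.
  by rewrite addnA addnC addnA.
have -> : - k%:Z - 1 + 1 = - k%:Z by lia.
case: e => [|e].
  rewrite (_ : rhom (- k%:Z - 1, 0%:Z + k%:Z) _ \in T = false) ?addn0 ?add0n;
    first by rewrite addnC.
  apply/negP => /TH'; rewrite rhom_hexagon /insideL /in_hexagon /=; lia.
have -> : e.+1%:Z + k%:Z = e%:Z + k%:Z + 1 by lia.
by rewrite addnC (addnC (rhom (- k%:Z - 1, _) _ \in T)).
Qed.

Lemma incidence_small T c k e : T `<=` hexagon_rhombi N M ->
  #|` [fset r in T | small_tri c k e \in (r : {fset _})]|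
  = ((lozV c k.+1 e \in T) + (lozU c k e \in T) + (lozD c k e \in T))%N.
Proof.
move=> TH; rewrite /small_tri /lozV /lozU /lozD.
case: c; [rewrite incidenceR //= | rewrite incidenceL //=].
  have -> : k.+1%:Z - 1 = k%:Z by lia.
  have -> : k.+1%:Z = k%:Z + 1 by lia.
  by rewrite addnA addnC addnA.
have -> : e%:Z + k%:Z + 1 - 1 = e%:Z + k%:Z by lia.
have -> : - k.+1%:Z = - k%:Z - 1 by lia.
have -> : e%:Z + k.+1%:Z = e%:Z + k%:Z + 1 by lia.
by rewrite addnC [in LHS](addnC (rhom _ (- k%:Z - 1, e%:Z + k%:Z) \in T)).
Qed.

Lemma big_tri_hexagon c k e :
  (big_tri c k e \in hexagon_triangles N M) = (k < N)%N && (e + k < N + M)%N.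
Proof.
rewrite /big_tri; case: c; rewrite ?triL_hexagon ?triR_hexagon /insideL /insideR
  /in_hexagon /=; lia.
Qed.

Lemma small_tri_hexagon c k e :
  (small_tri c k e \in hexagon_triangles N M) = (k < N)%N && (e.+1 + k < N + M)%N.
Proof.
rewrite /small_tri; case: c; rewrite ?triL_hexagon ?triR_hexagon /insideL /insideR
  /in_hexagon /=; lia.
Qed.

Lemma lozV_hexagon c k e :
  (lozV c k e \in hexagon_rhombi N M) = (k < N)%N && (e + k < N + M)%N.
Proof.
rewrite /lozV; case: c; rewrite rhom_hexagon /insideL /insideR /in_hexagon /adjacent
  /=; lia.
Qed.

Lemma lozU_hexagon c k e :
  (lozU c k e \in hexagon_rhombi N M) = (k < N)%N && (e.+1 + k < N + M)%N.
Proof.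
rewrite /lozU; case: c; rewrite rhom_hexagon /insideL /insideR /in_hexagon /adjacent
  /=; lia.
Qed.

Lemma lozD_hexagon c k e :
  (lozD c k e \in hexagon_rhombi N M) = (k < N)%N && (e.+1 + k < N + M)%N.
Proof.
rewrite /lozD; case: c; rewrite rhom_hexagon /insideL /insideR /in_hexagon /adjacent
  /=; lia.
Qed.
End HexagonRhombi.

Section HexagonTilings.
Variables N M : nat.
Implicit Types (p q : lattice_point) (t : {fset lattice_point}) (c : bool) (k e : nat).
Implicit Types (r : {fset {fset lattice_point}}) (T : {fset {fset {fset lattice_point}}}).

Lemma hexagon_triangles_cover t : t \in hexagon_triangles N M ->
  exists c k e, t = big_tri c k e \/ t = small_tri c k e.
Proof.
case/hexagon_trianglesP => [[a b]] [[-> H]|[-> H]].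
  have [a0|a0] := leP 0 a; [exists true, (absz a), (absz b); left | 
    exists false, (absz (- a - 1)), (absz (b + a)); right]; congr triL;
    move: H; rewrite /insideL /in_hexagon /= => H; congr (_, _); lia.
have [a0|a0] := leP 0 a; [exists true, (absz a), (absz b); right | 
  exists false, (absz (- a - 1)), (absz (b + a + 1)); left]; congr triR;
  move: H; rewrite /insideR /in_hexagon /= => H; congr (_, _); lia.
Qed.

Lemma hexagon_rhombi_cover r : r \in hexagon_rhombi N M ->
  exists c k e, [\/ r = lozV c k e, r = lozU c k e | r = lozD c k e].
Proof.
case/hexagon_rhombiP => [[a b] [[a' b'] [->]]].
rewrite /insideL /insideR /in_hexagon /= => H1 H2.
rewrite /adjacent /=; case/or3P => /andP[/eqP ea /eqP eb]; have [a0|a0] := leP 0 a.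
- exists true, (absz a), (absz b); constructor 2; apply/eqP;
  rewrite rhom_eq !xpair_eqE; lia.
- exists false, (absz (- a - 1)), (absz (b + a)); constructor 3; apply/eqP;
  rewrite rhom_eq !xpair_eqE; lia.
- exists true, (absz a), (absz (b - 1)); constructor 3; apply/eqP;
  rewrite rhom_eq !xpair_eqE; lia.
- exists false, (absz (- a - 1)), (absz (b + a)); constructor 2; apply/eqP;
  rewrite rhom_eq !xpair_eqE; lia.
- exists true, (absz a), (absz b); constructor 1; apply/eqP;
  rewrite rhom_eq !xpair_eqE; lia.
- exists false, (absz (- a)), (absz (b + a)); constructor 1; apply/eqP;
  rewrite rhom_eq !xpair_eqE; lia.
Qed.

Lemma lozV_eq c k e c' k' e' :
  (lozV c k e == lozV c' k' e') = [&& k == k', e == e' & (c == c') || (k == 0%N)].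
Proof.
rewrite /lozV; case: c; case: c'; rewrite rhom_eq !xpair_eqE; lia.
Qed.

Lemma lozU_eq c k e c' k' e' :
  (lozU c k e == lozU c' k' e') = [&& k == k', e == e' & c == c'].
Proof.
rewrite /lozU; case: c; case: c'; rewrite rhom_eq !xpair_eqE; lia.
Qed.

Lemma lozD_eq c k e c' k' e' :
  (lozD c k e == lozD c' k' e') = [&& k == k', e == e' & c == c'].
Proof.
rewrite /lozD; case: c; case: c'; rewrite rhom_eq !xpair_eqE; lia.
Qed.

Lemma lozVU c k e c' k' e' : (lozV c k e == lozU c' k' e') = false.
Proof. rewrite /lozV /lozU; case: c; case: c'; rewrite rhom_eq !xpair_eqE; lia. Qed.

Lemma lozVD c k e c' k' e' : (lozV c k e == lozD c' k' e') = false.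
Proof. rewrite /lozV /lozD; case: c; case: c'; rewrite rhom_eq !xpair_eqE; lia. Qed.

Lemma lozUD c k e c' k' e' : (lozU c k e == lozD c' k' e') = false.
Proof. rewrite /lozU /lozD; case: c; case: c'; rewrite rhom_eq !xpair_eqE; lia. Qed.

Lemma axis_rhombusE l : axis_rhombus l = lozV true 0 l.
Proof. by rewrite /lozV rhom.unlock. Qed.

(** Every triangle is big or small, and only three rhombi can cover it, so exact covering becomes
    one equation between three bits per triangle. The strips are solved in this form. *)
Lemma rhombus_tilingsP T : reflect
  [/\ T `<=` hexagon_rhombi N M,
      (forall c k e, (k < N)%N -> (e + k < N + M)%N ->
         ((lozV c k e \in T) + (lozU c k e \in T)
          + (if e is e'.+1 then (lozD c k e' \in T) : nat else 0) = 1)%N)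
    & (forall c k e, (k < N)%N -> (e.+1 + k < N + M)%N ->
         ((lozV c k.+1 e \in T) + (lozU c k e \in T) + (lozD c k e \in T) = 1)%N)]
  (T \in rhombus_tilings N M).
Proof.
rewrite /rhombus_tilings in_fset inE fpowersetE /=.
apply: (iffP andP) => [[TH /forallP H]|[TH B S]]; split=> //.
- move=> c k e kN eP; have tH : big_tri c k e \in hexagon_triangles N M.
    by rewrite big_tri_hexagon kN.
  by have /eqP := H [` tH]; rewrite (incidence_big _ _ _ TH).
- move=> c k e kN eP; have tH : small_tri c k e \in hexagon_triangles N M.
    by rewrite small_tri_hexagon kN.
  by have /eqP := H [` tH]; rewrite (incidence_small _ _ _ TH).
apply/forallP => -[t tH] /=; apply/eqP.
have [c [k [e [tE|tE]]]] := hexagon_triangles_cover tH; move: tH; rewrite tE.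
  by rewrite big_tri_hexagon => /andP[kN eP]; rewrite (incidence_big _ _ _ TH) B.
by rewrite small_tri_hexagon => /andP[kN eP]; rewrite (incidence_small _ _ _ TH) S.
Qed.

End HexagonTilings.

(** * Interlacing sets of holes *)

Section Interlacing.
Variable P : nat.
Implicit Types X Y : {set 'I_P}.

(** Membership extended by false to all naturals. A vertical rhombus at the e-th segment removes a
    triangle from the strip beside it, whence the name. *)
Definition hole X (e : nat) : bool := [exists x in X, val x == e].

Definition count_below X (e : nat) : nat := #|[set x in X | val x < e]|%N.

(* For X = {x_0 < ... < x_k} and Y = {y_0 < ... < y_(k-1)} this says that
   x_i <= y_i < x_(i+1), see [interlacesP]. *)
Definition interlaces X Y : bool :=
  (#|X| == #|Y|.+1)%N &&
  [forall e : 'I_P, (count_below Y e <= count_below X e)%N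
                    && (count_below X e.+1 <= (count_below Y e).+1)%N].

Definition positions X : seq nat := [seq val x | x <- enum X].

Lemma size_positions X : size (positions X) = #|X|.
Proof. by rewrite size_map cardE. Qed.

Lemma positions_sorted X : sorted ltn (positions X).
Proof.
have -> : positions X = [seq i <- iota 0 P | hole X i].
  rewrite -val_enum_ord filter_map /positions; congr map.
  rewrite /enum_mem -filter_predI; apply: eq_filter => x /=.
  rewrite andbT; apply/idP/existsP => [xX|[y /andP[yX /eqP/val_inj <-]] //].
  by exists x; rewrite xX /=.
by apply: sorted_filter; [exact: ltn_trans | exact: iota_ltn_sorted].
Qed.

Lemma mem_positions X (e : nat) : (e \in positions X) = hole X e.
Proof.
apply/mapP/existsP => [[x]|[x /andP[xX /eqP <-]]].
  by rewrite mem_enum => xX ->; exists x; rewrite xX eqxx.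
by exists x; rewrite ?mem_enum.
Qed.

Lemma count_belowE X (e : nat) : count_below X e = count (fun i => i < e)%N (positions X).
Proof.
rewrite /count_below /positions count_map cardE -size_filter; congr size.
rewrite /enum_mem -filter_predI; apply: eq_filter => x /=.
by rewrite inE andbC.
Qed.

(** In a sorted list the elements below e form a prefix. *)
Lemma nth_sorted_lt (s : seq nat) (i e : nat) : sorted ltn s -> (i < size s)%N ->
  (nth 0%N s i < e)%N = (i < count (fun x => x < e) s)%N.
Proof.
elim: s i => // a s IH i /= ps.
have as_ : all (ltn a) s by apply: order_path_min ps; exact: ltn_trans.
have small : (e <= a)%N -> count (fun x => x < e)%N s = 0%N.
  move=> ea; apply/eqP; rewrite -leqn0 leqNgt -has_count -all_predC.
  by apply: sub_all as_ => x /=; lia.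
case: i => [|i] /= is_.
  by case: (ltnP a e) => //= /small ->.
rewrite ltnS in is_; rewrite (IH _ (path_sorted ps) is_).
by case: (ltnP a e) => [_|/small ->]; rewrite ?add1n ?ltnS.
Qed.

(** [lX] and [lY] translate positions into counts; the two inequalities for i are the counting
    conditions at y_i + 1 and at x_(i+1). *)
Lemma interlacesP X Y (k : nat) : #|X| = k.+1 -> #|Y| = k ->
  reflect (forall i, (i < k)%N -> (nth 0%N (positions X) i <= nth 0%N (positions Y) i
                                  < nth 0%N (positions X) i.+1)%N)
          (interlaces X Y).
Proof.
move=> cX cY; rewrite /interlaces cX cY eqxx /=.
have lX i e : (i < k.+1)%N -> (nth 0%N (positions X) i < e)%N = (i < count_below X e)%N.
  by move=> ik; rewrite count_belowE nth_sorted_lt ?positions_sorted ?size_positions ?cX.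
have lY i e : (i < k)%N -> (nth 0%N (positions Y) i < e)%N = (i < count_below Y e)%N.
  by move=> ik; rewrite count_belowE nth_sorted_lt ?positions_sorted ?size_positions ?cY.
have bX i : (i < k.+1)%N -> (nth 0%N (positions X) i < P)%N.
  move=> ik; have : nth 0%N (positions X) i \in positions X by rewrite mem_nth //
    size_positions cX.
  by case/mapP => x _ ->; apply: ltn_ord.
have bY i : (i < k)%N -> (nth 0%N (positions Y) i < P)%N.
  move=> ik; have : nth 0%N (positions Y) i \in positions Y by rewrite mem_nth //
    size_positions cY.
  by case/mapP => x _ ->; apply: ltn_ord.
have mX e : (count_below X e <= k.+1)%N by rewrite count_belowE -cX -size_positions
  count_size.
have mY e : (count_below Y e <= k)%N by rewrite count_belowE -cY -size_positions
  count_size.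
apply: (iffP forallP) => [H i ik|H e].
  apply/andP; split.
    rewrite -ltnS lX; last by lia.
    (* The counting condition is available only for e < P; if y_i = P - 1, then x_i <= y_i holds
       anyway. *)
    have [e1 | e1] := ltnP (nth 0%N (positions Y) i).+1 P.
      have /andP[h _] := H (Ordinal e1); apply: leq_trans h.
      by rewrite -lY.
    rewrite -lX; last by lia.
    by apply: leq_trans e1; apply: bX; lia.
  have /andP[_ h] := H (Ordinal (bX i.+1 ik)).
  rewrite lY //; rewrite -ltnS; apply: leq_trans h.
  by rewrite -lX.
apply/andP; split.
  case E : (count_below Y e) => [//|i].
  have ik : (i < k)%N by have := mY e; lia.
  have /andP[h _] := H i ik.
  by rewrite -lX; [apply: leq_ltn_trans h _; rewrite lY // E | lia].
case E : (count_below X e.+1) => [//|[//|i]].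
have ik : (i < k)%N by have := mX e.+1; lia.
have /andP[_ h] := H i ik.
rewrite ltnS -lY //; apply: leq_trans h _.
by rewrite -ltnS lX // E.
Qed.

End Interlacing.

(** * Perfect matchings of a single strip *)

Section Strips.
Variable P : nat.
Implicit Types X Y : {set 'I_P}.

Lemma count_below0 X : count_below X 0 = 0%N.
Proof. by rewrite /count_below; apply: eq_card0 => x; rewrite !inE ltn0 andbF. Qed.

Lemma count_belowS X e : count_below X e.+1 = (count_below X e + hole X e)%N.
Proof.
rewrite !count_belowE -mem_positions; have := positions_sorted X.
move/(sorted_uniq ltn_trans ltnn) => u; rewrite -(count_uniq_mem _ u).
by elim: (positions X) {u} => //= x s ->; lia.
Qed.

Lemma hole_lt X e : hole X e -> (e < P)%N.
Proof. by case/existsP => x /andP[_ /eqP <-]; exact: ltn_ord. Qed.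

Lemma count_below_le X e : (count_below X e <= #|X|)%N.
Proof. by apply: subset_leq_card; apply/subsetP => x; rewrite inE => /andP[]. Qed.

Lemma count_below_all X e :
  (forall i, hole X i -> i < e)%N -> count_below X e = #|X|.
Proof.
move=> H; apply: eq_card => x; rewrite inE; case xX: (x \in X) => //=.
by apply: H; apply/existsP; exists x; rewrite xX eqxx.
Qed.

Lemma count_below_lt X e : count_below X e = #|X| -> forall i, hole X i -> (i < e)%N.
Proof.
move=> /eqP c i /existsP[x /andP[xX /eqP <-]].
have sub : [set x in X | val x < e]%N \subset X by apply/subsetP => y;
  rewrite inE => /andP[].
have eX : [set x in X | val x < e]%N = X.
  by apply/eqP; rewrite eqEcard sub -(eqP c) leqnn.
by move: xX; rewrite -{1}eX inE => /andP[].
Qed.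

Lemma interlaces_le X Y e : interlaces X Y ->
  (count_below Y e <= count_below X e)%N /\ (count_below X e.+1 <= (count_below Y
    e).+1)%N.
Proof.
case/andP => /eqP cXY /forallP H; have [eP|eP] := ltnP e P.
  by have /andP[] := H (Ordinal eP).
have big (Z : {set 'I_P}) i : (P <= i)%N -> count_below Z i = #|Z|.
  by move=> Pi; apply: count_below_all => j /hole_lt; lia.
by rewrite !big //; lia.
Qed.

(* Between two consecutive vertical lines the uncovered triangles form a path, so its
   perfect matching (u, d) is determined by the holes from bottom to top. *)
Lemma strip_solve X Y q (u d : nat -> bool) :
  (forall e, hole X e -> e < q)%N -> (forall e, hole Y e -> e.+1 < q)%N ->
  (forall e, u e -> e.+1 < q)%N ->
  (forall e, e < q -> hole X e + u e + (if e is e'.+1 then d e' : nat else 0) = 1)%N ->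
  (forall e, e.+1 < q -> hole Y e + u e + d e = 1)%N ->
  (0 < q)%N ->
  [/\ interlaces X Y,
      (forall e, e < q -> u e + count_below X e.+1 = (count_below Y e).+1)%N
    & (forall e, e.+1 < q -> d e + count_below Y e.+1 = count_below X e.+1)%N].
Proof.
move=> hX hY hu B S q0.
(* Going up the path, the equation of each triangle determines the next unknown; the two counting
   identities are the invariants. *)
have main e : (e < q)%N -> (u e + count_below X e.+1 = (count_below Y e).+1)%N /\
   ((e.+1 < q)%N -> d e + count_below Y e.+1 = count_below X e.+1)%N.
  elim: e => [|e IH] eq.
    have := B 0%N eq; have := S 0%N; rewrite !count_belowS !count_below0.
    by move=> s b; split=> [|e1]; [|have := s e1]; lia.
  have [i1 i2] := IH (ltnW eq); have := i2 eq; have := B _ eq; have := S e.+1.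
  rewrite (count_belowS X e.+1) (count_belowS Y e.+1) => s b i3.
  by split=> [|e1]; [|have := s e1]; lia.
have U e : (e < q)%N -> (u e + count_below X e.+1 = (count_below Y e).+1)%N.
  by move=> /main[].
have D e : (e.+1 < q)%N -> (d e + count_below Y e.+1 = count_below X e.+1)%N.
  by move=> eq; have [_] := main e (ltnW eq); apply.
split=> //; have cX i : (q <= i)%N -> count_below X i = #|X|.
  by move=> qi; apply: count_below_all => j /hX; lia.
have cY i : (q.-1 <= i)%N -> count_below Y i = #|Y|.
  by move=> qi; apply: count_below_all => j /hY; lia.
(* The path ends with a big triangle that has no small one above it, so [u q.-1] is false and the
   first identity at the top compares the cardinals. *)
have cXY : #|X| = #|Y|.+1.
  have ql : (q.-1 < q)%N by rewrite prednK.
  have := U _ ql; rewrite prednK // cX // cY //.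
  by case E : (u q.-1) => //; have := hu _ E; rewrite prednK // ltnn.
rewrite /interlaces cXY eqxx /=; apply/forallP => e.
have [eq|qe] := ltnP e q; last by rewrite (cX e qe) (cX e.+1 (leqW qe)) (cY e) ?cXY; lia.
apply/andP; split; last by have := U e eq; lia.
by case: (nat_of_ord e) eq => [|i] eq; rewrite ?count_below0 //; have := D i eq; lia.
Qed.

(** The counting identities of [strip_solve], solved for u here and for d in [strip_down]. *)
Definition strip_up X Y (e : nat) : bool := count_below X e.+1 == count_below Y e.
Definition strip_down X Y (e : nat) : bool := count_below Y e.+1 != count_below X e.+1.

Lemma strip_build X Y q : interlaces X Y -> (forall e, hole X e -> e < q)%N ->
  [/\ (forall e, hole Y e -> e.+1 < q)%N,
      (forall e, e < q -> strip_up X Y e -> e.+1 < q)%N,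
      (forall e, hole X e + strip_up X Y e
                 + (if e is e'.+1 then strip_down X Y e' : nat else 0) = 1)%N
    & (forall e, hole Y e + strip_up X Y e + strip_down X Y e = 1)%N].
Proof.
move=> iXY hX; have ile e := interlaces_le e iXY.
have cXY : #|X| = #|Y|.+1 by case/andP: iXY => /eqP.
have cX : count_below X q = #|X| by exact: count_below_all.
have q0 : (0 < q)%N.
  by case: q cX {hX} => //; rewrite count_below0 cXY.
have cY : count_below Y q.-1 = #|Y|.
  by have [_] := ile q.-1; have := count_below_le Y q.-1; rewrite prednK //; lia.
split.
- by move=> e /(count_below_lt cY); lia.
- move=> e eq; rewrite /strip_up; have [|qe] := ltnP e.+1 q => //.
  have -> : e = q.-1 by lia.
  by rewrite prednK // cX cY cXY => /eqP; lia.
- move=> e; rewrite /strip_up /strip_down; case: e => [|e].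
    by have := ile 0%N; rewrite !count_belowS !count_below0; lia.
  by have := ile e.+1; have := ile e; rewrite !(count_belowS _ e.+1); lia.
- by move=> e; rewrite /strip_up /strip_down; have := ile e.+1; have := ile e;
    rewrite !(count_belowS _ e.+1) !(count_belowS _ e); lia.
Qed.

End Strips.

(** * Tilings as pairs of interlacing chains with a common top row *)

Section TilingChains.
Variables N M : nat.
Implicit Types (p q : lattice_point) (t : {fset lattice_point}) (c : bool) (k e : nat).
Implicit Types (r : {fset {fset lattice_point}}) (T : {fset {fset {fset lattice_point}}}).
Local Notation P := (N + M)%N.
Local Notation chains :=
  ({set 'I_P} * (N.-tuple {set 'I_P} * N.-tuple {set 'I_P}))%type.
Implicit Types z : chains.

Definition hole_set T c k : {set 'I_P} := [set e : 'I_P | lozV c k e \in T].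

Definition hole_chains T : chains :=
  (hole_set T true 0, ([tuple hole_set T true i.+1 | i < N],
                       [tuple hole_set T false i.+1 | i < N])).

Definition good_chains z : bool :=
  [&& #|z.1| == N, path (@interlaces P) z.1 z.2.1 & path (@interlaces P) z.1 z.2.2].

(* The vertical rhombi on the k-th line of the half c;
  both halves share the axis k = 0. *)
Definition hole_line z c k :=
  nth set0 (z.1 :: (if c then z.2.1 else z.2.2)) k.

Lemma hole_line_chains T c k : (k <= N)%N
  -> hole_line (hole_chains T) c k = hole_set T c k.
Proof.
case: k => [|k] kN.
  apply/setP => e; rewrite /hole_line /= !inE.
  by rewrite (eqP (_ : lozV c 0 e == lozV true 0 e)) // lozV_eq !eqxx orbT.
by rewrite /hole_line; case: c;
  rewrite -[nth _ _ _](tnth_nth set0 _ (Ordinal kN)) tnth_mktuple.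
Qed.

Lemma good_chainsP z : reflect
  (#|z.1| = N /\ forall c k, (k < N)%N
    -> interlaces (hole_line z c k) (hole_line z c k.+1))
  (good_chains z).
Proof.
rewrite /good_chains /hole_line;
  apply: (iffP and3P) => [[/eqP cz /(pathP set0) p1 /(pathP set0) p2]|[cz H]].
  split=> // c k kN; case: c; [apply: p1 | apply: p2]; by rewrite size_tuple.
split; first exact/eqP.
  by apply/(pathP set0) => i; rewrite size_tuple => iN; have := H true i iN.
by apply/(pathP set0) => i; rewrite size_tuple => iN; have := H false i iN.
Qed.

Lemma good_line_lt z c k : good_chains z -> (k <= N)%N ->
  #|hole_line z c k| = (N - k)%N /\ forall e, hole (hole_line z c k) e -> (e < P - k)%N.
Proof.
case/good_chainsP => cz H; elim: k => [|k IH] kN.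
  by split; [rewrite subn0 | move=> e /hole_lt; rewrite subn0].
have [IH1 IH2] := IH (ltnW kN); have [hY _ _ _] := strip_build (H c k kN) IH2.
split; last by move=> e /hY; lia.
by have /andP[/eqP] := H c k kN; lia.
Qed.

Lemma tiling_strip T c k : T \in rhombus_tilings N M -> (k < N)%N ->
  [/\ interlaces (hole_set T c k) (hole_set T c k.+1),
      (forall e, (e + k < P)%N -> (lozU c k e \in T)
          = strip_up (hole_set T c k) (hole_set T c k.+1) e)
    & (forall e, (e.+1 + k < P)%N -> (lozD c k e \in T)
          = strip_down (hole_set T c k) (hole_set T c k.+1) e)].
Proof.
case/rhombus_tilingsP => TH B S kN; have TH' := fsubsetP TH.
have holeE j e : hole (hole_set T c j) e = (lozV c j e \in T).
  apply/existsP/idP => [[x]|VT]; first by rewrite inE => /andP[xT /eqP <-].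
  have := TH' _ VT; rewrite lozV_hexagon => /andP[_ eP].
  have eP' : (e < P)%N by lia.
  by exists (Ordinal eP'); rewrite inE VT /=.
have [] := @strip_solve P (hole_set T c k) (hole_set T c k.+1) (P - k)
   (fun e => lozU c k e \in T) (fun e => lozD c k e \in T).
- by move=> e; rewrite holeE => /TH'; rewrite lozV_hexagon; lia.
- by move=> e; rewrite holeE => /TH'; rewrite lozV_hexagon; lia.
- by move=> e /TH'; rewrite lozU_hexagon; lia.
- by move=> e eq; rewrite holeE; apply: B; lia.
- by move=> e eq; rewrite holeE; apply: S; lia.
- by lia.
move=> iXY U D; split=> // e eP; rewrite /strip_up /strip_down.
  have eq : (e < P - k)%N by lia.
  by have := U e eq; case: (_ \in T) => ?; apply/esym; [apply/eqP | apply/negbTE/eqP];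
    lia.
have eq : (e.+1 < P - k)%N by lia.
by have := D e eq; case: (_ \in T) => ?; apply/esym;
  [apply/eqP | apply/negbTE/negPn/eqP]; lia.
Qed.

Lemma hole_chains_good T : T \in rhombus_tilings N M -> good_chains (hole_chains T).
Proof.
move=> TT; apply/good_chainsP.
have H c k : (k < N)%N -> interlaces (hole_line (hole_chains T) c k) (hole_line
  (hole_chains T) c k.+1).
  move=> kN; rewrite (@hole_line_chains T c k (ltnW kN)) (@hole_line_chains T c k.+1 kN).
  by have [] := tiling_strip c TT kN.
split=> //.
(* The axis holes are counted from the far end: line N carries none, and each step away from the
   axis loses exactly one. *)
have step k : (k <= N)%N -> #|hole_line (hole_chains T) true 0|
  = (k + #|hole_line (hole_chains T) true k|)%N.
  elim: k => [|k IH] kN //; rewrite IH; last exact: ltnW.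
  by have /andP[/eqP -> _] := H true k kN; rewrite addnS.
have := step N (leqnn _); rewrite (@hole_line_chains T true N (leqnn N)) (_ : hole_set
  T true N = set0); last first.
  have [TH _ _] := elimT (rhombus_tilingsP _ _ _) TT.
  apply/setP => e; rewrite !inE; apply/negP => /(fsubsetP TH).
  by rewrite lozV_hexagon ltnn.
by rewrite cards0 addn0.
Qed.

(** By [tiling_strip], the vertical rhombi decide the rhombi of the two other types. *)
Lemma hole_chains_inj : {in rhombus_tilings N M &, injective hole_chains}.
Proof.
suff H T T' : T \in rhombus_tilings N M -> T' \in rhombus_tilings N M ->
    hole_chains T = hole_chains T' -> T `<=` T'.
  by move=> T T' TT TT' e; apply/eqP; rewrite eqEfsubset !H.
move=> TT TT' eTT; apply/fsubsetP => r rT.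
have [TH _ _] := elimT (rhombus_tilingsP _ _ _) TT.
have E c k : (k <= N)%N -> hole_set T c k = hole_set T' c k.
  by move=> kN; rewrite -!hole_line_chains // eTT.
have := fsubsetP TH r rT; have [c [k [e [rE|rE|rE]]]] := hexagon_rhombi_cover (fsubsetP
  TH r rT);
  move: rT; rewrite {}rE.
- rewrite lozV_hexagon => VT /andP[kN eP].
  have eP' : (e < P)%N by lia.
  have : Ordinal eP' \in hole_set T c k by rewrite inE.
  by rewrite E ?inE // ltnW.
- rewrite lozU_hexagon => UT /andP[kN eP].
  have [_ h _] := tiling_strip c TT kN; have [_ h' _] := tiling_strip c TT' kN.
  by rewrite h' -?E ?(ltnW kN) // -?h //; lia.
- rewrite lozD_hexagon => UT /andP[kN eP].
  have [_ _ h] := tiling_strip c TT kN; have [_ _ h'] := tiling_strip c TT' kN.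
  by rewrite h' -?E ?(ltnW kN) // -?h //; lia.
Qed.

Definition chain_rhombus z r : bool := [exists c : bool, exists k : 'I_N, exists e : 'I_P,
  [|| hole (hole_line z c k) e && (r == lozV c k e),
      strip_up (hole_line z c k) (hole_line z c k.+1) e && (r == lozU c k e)
    | strip_down (hole_line z c k) (hole_line z c k.+1) e && (r == lozD c k e)]].

Lemma chain_rhombusP z r : reflect (exists c k e, [/\ (k < N)%N, (e < P)%N &
    [\/ hole (hole_line z c k) e /\ r == lozV c k e,
        strip_up (hole_line z c k) (hole_line z c k.+1) e /\ r == lozU c k e
      | strip_down (hole_line z c k) (hole_line z c k.+1) e /\ r == lozD c k e]])
  (chain_rhombus z r).
Proof.
apply: (iffP existsP) => [[c /existsP[k /existsP[e H]]]|[c [k [e [kN eP H]]]]]; exists c.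
  exists k, e; split=> //; move: H; case/or3P => /andP[h re].
  - by constructor 1.
  - by constructor 2.
  - by constructor 3.
apply/existsP; exists (Ordinal kN); apply/existsP; exists (Ordinal eP).
by case: H => -[h re]; apply/or3P; [constructor 1 | constructor 2 | constructor 3];
  apply/andP.
Qed.

Lemma chain_rhombusV z c k e : (k < N)%N -> (e < P)%N ->
  chain_rhombus z (lozV c k e) = hole (hole_line z c k) e.
Proof.
move=> kN eP; apply/chain_rhombusP/idP => [[c' [k' [e' [_ _]]]]|h]; last first.
  by exists c, k, e; split=> //; constructor 1.
case=> -[h]; [rewrite lozV_eq | by rewrite lozVU | by rewrite lozVD].
case/and3P => /eqP -> /eqP -> /orP[/eqP -> //|/eqP k0].
by move: h; rewrite -?k0; case: c c' => -[]; rewrite ?k0.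
Qed.

Lemma chain_rhombusU z c k e : (k < N)%N -> (e < P)%N ->
  chain_rhombus z (lozU c k e) = strip_up (hole_line z c k) (hole_line z c k.+1) e.
Proof.
move=> kN eP; apply/chain_rhombusP/idP => [[c' [k' [e' [_ _]]]]|h]; last first.
  by exists c, k, e; split=> //; constructor 2.
case=> -[h]; [by rewrite eq_sym lozVU | rewrite lozU_eq | by rewrite lozUD].
by case/and3P => /eqP -> /eqP -> /eqP ->.
Qed.

Lemma chain_rhombusD z c k e : (k < N)%N -> (e < P)%N ->
  chain_rhombus z (lozD c k e) = strip_down (hole_line z c k) (hole_line z c k.+1) e.
Proof.
move=> kN eP; apply/chain_rhombusP/idP => [[c' [k' [e' [_ _]]]]|h]; last first.
  by exists c, k, e; split=> //; constructor 3.
case=> -[h]; [by rewrite eq_sym lozVD | by rewrite eq_sym lozUD | rewrite lozD_eq].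
by case/and3P => /eqP -> /eqP -> /eqP ->.
Qed.

(** The intersection matters: for good chains [strip_down] is true above the top of a strip, so
    [chain_rhombus] also accepts rhombi that leave the hexagon. *)
Definition chain_tiling z : {fset {fset {fset lattice_point}}} :=
  [fset r in hexagon_rhombi N M | chain_rhombus z r].

Lemma in_chain_tiling z r :
  (r \in chain_tiling z) = (r \in hexagon_rhombi N M) && chain_rhombus z r.
Proof. by rewrite in_fset. Qed.

Lemma mem_chain_tiling z c k e : (k < N)%N -> (e + k < P)%N ->
  [/\ (lozV c k e \in chain_tiling z) = hole (hole_line z c k) e,
      (lozU c k e \in chain_tiling z)
        = (e.+1 + k < P)%N && strip_up (hole_line z c k) (hole_line z c k.+1) e
    & (lozD c k e \in chain_tiling z)
        = (e.+1 + k < P)%N && strip_down (hole_line z c k) (hole_line z c k.+1) e].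
Proof.
move=> kN eP; have eP' : (e < P)%N by lia.
split; rewrite in_chain_tiling.
- by rewrite lozV_hexagon kN eP chain_rhombusV.
- by rewrite lozU_hexagon kN chain_rhombusU.
- by rewrite lozD_hexagon kN chain_rhombusD.
Qed.

Lemma chain_tiling_sub z : chain_tiling z `<=` hexagon_rhombi N M.
Proof. by apply/fsubsetP => r; rewrite in_chain_tiling => /andP[]. Qed.

Lemma chain_tilingK z : good_chains z -> hole_chains (chain_tiling z) = z.
Proof.
move=> gz.
have hs c k : (k <= N)%N -> hole_set (chain_tiling z) c k = hole_line z c k.
  move=> kN; have [cz hz] := good_line_lt c gz kN.
  have mem (e : 'I_P) : hole (hole_line z c k) e = (e \in hole_line z c k).
    by apply/existsP/idP => [[x /andP[xz /eqP/val_inj <-]]|ez] //; exists e;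
      rewrite ez eqxx.
  apply/setP => e; rewrite inE; move: kN; rewrite leq_eqVlt => /predU1P[kN|kN].
    move/eqP: cz; rewrite kN subnn cards_eq0 => /eqP ->; rewrite in_set0.
    by apply/negP => /(fsubsetP (chain_tiling_sub z)); rewrite lozV_hexagon ltnn.
  have [eP|eP] := ltnP (e + k) P; first by have [-> _ _] := mem_chain_tiling z c kN eP.
  rewrite -mem; apply/idP/idP => [/(fsubsetP (chain_tiling_sub z))|/hz]; last by lia.
  by rewrite lozV_hexagon; lia.
case: z gz hs => X [p1 p2] gz hs; rewrite /hole_chains.
congr (_, (_, _)); first by rewrite hs.
  apply/eq_from_tnth => i; rewrite tnth_mktuple hs // /hole_line /=.
  by rewrite (tnth_nth set0).
apply/eq_from_tnth => i; rewrite tnth_mktuple hs // /hole_line /=.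
by rewrite (tnth_nth set0).
Qed.

Lemma chain_tiling_mem z : good_chains z -> chain_tiling z \in rhombus_tilings N M.
Proof.
move=> gz; have [cz iz] := good_chainsP _ gz.
apply/rhombus_tilingsP; split; first exact: chain_tiling_sub.
- move=> c k e kN eP; have [-> -> _] := mem_chain_tiling z c kN eP.
  have [_ hz] := good_line_lt c gz (ltnW kN).
  have [_ hu hB _] := strip_build (iz c k kN) hz.
  have -> : (e.+1 + k < P)%N && strip_up (hole_line z c k) (hole_line z c k.+1) e
     = strip_up (hole_line z c k) (hole_line z c k.+1) e.
    by case E : (strip_up _ _ e); rewrite ?andbF // andbT; have := hu e; rewrite E; lia.
  rewrite -[RHS](hB e); congr (_ + _)%N; case: e eP => // e eP.
  have eP' : (e + k < P)%N by lia.
  by have [_ _ ->] := mem_chain_tiling z c kN eP'; rewrite eP.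
- move=> c k e kN eP; have eP' : (e + k < P)%N by lia.
  have [_ -> ->] := mem_chain_tiling z c kN eP'; rewrite eP /=.
  have [_ hz] := good_line_lt c gz (ltnW kN).
  have [hY _ _ hS] := strip_build (iz c k kN) hz.
  rewrite -[RHS](hS e); congr (_ + _ + _)%N; congr nat_of_bool.
  have [kN'|kN'] := ltnP k.+1 N.
    have eP2 : (e + k.+1 < P)%N by lia.
    by have [-> _ _] := mem_chain_tiling z c kN' eP2.
  (* Here k + 1 = N: the line is a side of the hexagon, and both bits are false. *)
  have [c0 _] := good_line_lt c gz kN.
  have -> : hole (hole_line z c k.+1) e = false.
    have /eqP : #|hole_line z c k.+1| = 0%N by rewrite c0; lia.
    rewrite cards_eq0 => /eqP ->.
    by apply/negbTE/existsPn => x; rewrite in_set0.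
  by apply/negP => /(fsubsetP (chain_tiling_sub z)); rewrite lozV_hexagon; lia.
Qed.

Lemma num_tilings_chains (l : 'I_P) :
  num_tilings_containing N M l = #|[set z | good_chains z && (l \in z.1)]|.
Proof.
rewrite /num_tilings_containing; set A := [fset T in _ | _]; set S := [set z | _].
have lz T : (l \in (hole_chains T).1) = (axis_rhombus l \in T).
  by rewrite inE axis_rhombusE.
have memA T : (T \in A) = (T \in rhombus_tilings N M) && (axis_rhombus l \in T).
  by rewrite in_fset.
apply/eqP; rewrite eqn_leq; apply/andP; split.
  rewrite -(size_map hole_chains) cardE; apply: uniq_leq_size.
    rewrite map_inj_in_uniq ?fset_uniq // => T T'; rewrite !memA.
    by move=> /andP[TT _] /andP[TT' _]; apply: hole_chains_inj.
  move=> _ /mapP[T + ->]; rewrite memA mem_enum /S in_set lz => /andP[TT ->].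
  by rewrite hole_chains_good.
rewrite cardE -(size_map chain_tiling); apply: uniq_leq_size.
  rewrite map_inj_in_uniq ?enum_uniq // => z z'; rewrite !mem_enum !in_set.
  by move=> /andP[gz _] /andP[gz' _] /(congr1 hole_chains); rewrite !chain_tilingK.
move=> _ /mapP[z + ->]; rewrite mem_enum inE => /andP[gz lz1].
by rewrite memA chain_tiling_mem //= -lz chain_tilingK.
Qed.

(** Once the axis set is given, the two halves are filled independently; this produces the
    square. *)
Lemma card_good_chains (l : 'I_P) : #|[set z | good_chains z && (l \in z.1)]|
  = (\sum_(X : {set 'I_P} | (#|X| == N) && (l \in X))
      #|[set p : N.-tuple {set 'I_P} | path (@interlaces P) X p]| ^ 2)%N.
Proof.
rewrite -sum1_card (eq_bigl (fun z : chains =>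
  ((#|z.1| == N) && (l \in z.1)) && (z.2 \in finset.setX
     [set p : N.-tuple {set 'I_P} | path (@interlaces P) z.1 p]
     [set p : N.-tuple {set 'I_P} | path (@interlaces P) z.1 p]))) => [|z]; last first.
  case: z => X [p1 p2]; rewrite finset.in_setX !in_set /good_chains /=.
  by case: (#|X| == N) => //=; case: (l \in X); rewrite ?andbF ?andbT.
rewrite -(pair_big_dep (fun X : {set 'I_P} => (#|X| == N) && (l \in X))
  (fun X (w : N.-tuple {set 'I_P} * N.-tuple {set 'I_P}) => w \in finset.setX
     [set p : N.-tuple {set 'I_P} | path (@interlaces P) X p]
     [set p : N.-tuple {set 'I_P} | path (@interlaces P) X p]) (fun _ _ => 1%N)) /=.
by apply: eq_bigr => X _; rewrite sum1_card cardsX mulnn.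
Qed.

End TilingChains.

(** * Sums of squared determinants *)

Section Andreief.
Variables (F : comNzRingType) (T : finType).

(** Multilinearity in the rows. It serves both Andreief's identity and the interlacing sum. *)
Lemma det_sum_rows N (a : 'I_N -> T -> F) (b : 'I_N -> T -> 'I_N -> F) :
  \det (\matrix_(i, j) \sum_x a i x * b i x j)
  = \sum_(f : {ffun 'I_N -> T})
      (\prod_i a i (f i)) * \det (\matrix_(i, j) b i (f i) j).
Proof.
rewrite /determinant (eq_bigr (fun s : 'S_N => \sum_(f : {ffun 'I_N -> T})
  (-1) ^+ s * \prod_i (a i (f i) * b i (f i) (s i)))) => [|s _]; last first.
  rewrite -mulr_sumr; congr (_ * _).
  rewrite -(bigA_distr_bigA (fun i x => a i x * b i x (s i))).
  by apply: eq_bigr => i _; rewrite mxE.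
rewrite exchange_big; apply: eq_bigr => f _ /=.
rewrite mulr_sumr; apply: eq_bigr => s _.
rewrite big_split /= mulrCA; congr (_ * (_ * _)).
by apply: eq_bigr => i _; rewrite mxE.
Qed.

Definition eval_mx N (phi : nat -> T -> F) (f : 'I_N -> T) : 'M[F]_N :=
  \matrix_(i, j) phi j (f i).

Lemma det_eval_perm N (phi : nat -> T -> F) (f : 'I_N -> T) (s : 'S_N) :
  \det (eval_mx phi (f \o s)) = (-1) ^+ s * \det (eval_mx phi f).
Proof.
rewrite -det_perm -det_mulmx -row_permE; congr (\det _).
by apply/matrixP => i j; rewrite !mxE.
Qed.

(* Andreief's identity; summing over all maps instead of over sets of size N only costs
   the factor N!. *)
Lemma andreief N (phi : nat -> T -> F) (w : T -> F) :
  N`!%:R * \det (\matrix_(i < N, j < N) \sum_x w x * phi i x * phi j x)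
  = \sum_(f : {ffun 'I_N -> T})
      (\prod_i w (f i)) * \det (eval_mx phi f) ^+ 2.
Proof.
rewrite mulr_natl -{1}(card_Sn N) -sumr_const.
(* In the copy of the determinant indexed by s, the map f is replaced by its composite with s^-1.
   The resulting signs make the sum over s a second determinant. *)
transitivity (\sum_(s : 'S_N) \sum_(f : {ffun 'I_N -> T})
   (\prod_i (w (f i) * phi (s i) (f i))) * ((-1) ^+ s * \det (eval_mx phi f))).
  apply: eq_big => [s|s _]; first by rewrite inE.
  rewrite det_sum_rows (reindex_inj (h := fun f : {ffun 'I_N
    -> T} => [ffun i => f ((s^-1)%g i)])).
    apply: eq_bigr => f _; congr (_ * _).
      rewrite (reindex_inj (@perm_inj _ s)); apply: eq_bigr => i _.
      by rewrite ffunE permK.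
    rewrite -odd_permV -det_eval_perm; congr (\det _).
    by apply/matrixP => i j; rewrite !mxE ffunE.
  move=> f g /ffunP e; apply/ffunP => i; have := e (s i).
  by rewrite !ffunE permK.
rewrite exchange_big; apply: eq_bigr => f _ /=.
rewrite expr2 {2}/determinant mulrA mulr_sumr; apply: eq_bigr => s _.
rewrite [\prod_i eval_mx phi f i (s i)](eq_bigr (fun i => phi (s i) (f i))) => [|i _];
  last by rewrite mxE.
rewrite big_split /= -!mulrA; congr (_ * _).
by rewrite mulrC -!mulrA mulrCA mulrA mulrC.
Qed.

Definition set_det (phi : nat -> T -> F) (X : {set T}) : F :=
  \det (eval_mx phi (fun i : 'I_#|X| => enum_val i)).

(** Two enumerations of X differ by a permutation, whose sign disappears in the square. *)
Lemma sqr_det_eval N (phi : nat -> T -> F) (X : {set T}) (f : 'I_N -> T) :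
  #|X| = N -> injective f -> (forall i, f i \in X) ->
  \det (eval_mx phi f) ^+ 2 = set_det phi X ^+ 2.
Proof.
move=> cX; move: f; rewrite -cX => f finj fX {N cX}.
pose g i := enum_rank_in (fX i) (f i).
have gK i : enum_val (g i) = f i by rewrite enum_rankK_in.
have ginj : injective g by move=> i j /(congr1 enum_val); rewrite !gK => /finj.
have := det_eval_perm phi (fun i : 'I_#|X| => enum_val i) (perm ginj).
rewrite /set_det; set A := \det _ => e.
have -> : \det (eval_mx phi f) = A.
  by rewrite /A; congr (\det _); apply/matrixP => i j; rewrite !mxE /= permE gK.
by rewrite e exprMn sqrr_sign mul1r.
Qed.

Lemma det_eval_noninj N (phi : nat -> T -> F) (f : 'I_N -> T) :
  ~~ injectiveb f -> \det (eval_mx phi f) = 0.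
Proof.
case/injectivePn => i [j ij fij]; apply: (determinant_alternate ij) => k.
by rewrite !mxE fij.
Qed.

(** Maps that are not injective give two equal rows, and each set of size N is the image of N!
    injective maps. *)
Lemma sum_set_det_fact N (phi : nat -> T -> F) (w : T -> F) :
  N`!%:R * \det (\matrix_(i < N, j < N) \sum_x w x * phi i x * phi j x)
  = N`!%:R * \sum_(X : {set T} | #|X| == N) (\prod_(x in X) w x) * set_det phi X ^+ 2.
Proof.
rewrite andreief (bigID (fun f : {ffun 'I_N -> T} => injectiveb f)) /=.
rewrite [X in _ + X]big1 ?addr0; last first.
  by move=> f /(det_eval_noninj phi) ->; rewrite expr0n mulr0.
rewrite (partition_big (fun f : {ffun 'I_N -> T} => [set f i | i : 'I_N])
           (fun X : {set T} => #|X| == N)) /=; last first.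
  by move=> f /injectiveP fi; rewrite card_imset // card_ord.
rewrite mulr_sumr; apply: eq_bigr => X /eqP cX.
rewrite (eq_bigr (fun=> (\prod_(x in X) w x) * set_det phi X ^+ 2)); last first.
  move=> f /andP[/injectiveP fi /eqP fX]; congr (_ * _).
    rewrite -fX big_imset //=; last by move=> ? ? _ _; apply: fi.
  by apply: sqr_det_eval => // i; rewrite -fX imset_f.
rewrite sumr_const mulr_natl; congr (_ *+ _).
have := card_inj_ffuns_on 'I_N (mem X); rewrite card_ord cX ffactnn => <-.
rewrite cardsE; apply: eq_card => f; rewrite unfold_in [in RHS]unfold_in.
 apply/andP/andP => [[fi /eqP fX]|[/ffun_onP fX fi]]; split=> //.
  by apply/ffun_onP => i; rewrite -fX imset_f.
rewrite eqEcard; apply/andP; split; first by apply/subsetP => _ /imsetP[i _ ->];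
  exact: fX.
by rewrite card_imset ?card_ord ?cX //; apply/injectiveP.
Qed.

End Andreief.

Section CauchyBinet.
Variables (F : numFieldType) (T : finType).

Lemma cauchy_binet N (phi : nat -> T -> F) (w : T -> F) :
  \sum_(X : {set T} | #|X| == N) (\prod_(x in X) w x) * set_det phi X ^+ 2
  = \det (\matrix_(i < N, j < N) \sum_x w x * phi i x * phi j x).
Proof.
by apply: (mulfI _ (esym (sum_set_det_fact N phi w)));
  rewrite pnatr_eq0 -lt0n fact_gt0.
Qed.

(** The matrix with blocks 1, r, c, H has the Schur complements H - c r and 1 - r H^-1 c;
    eliminating either diagonal block computes the same determinant. *)
Lemma det_diag_sub_outer N (h v : 'I_N -> F) : (forall i, h i != 0) ->
  \det (\matrix_(i, j) (h i *+ (i == j) - v i * v j))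
  = (\prod_i h i) * (1 - \sum_i v i ^+ 2 / h i).
Proof.
move=> h0; pose H := diag_mx (\row_i h i); pose r := \row_i v i; pose c := r^T.
have H1 : block_mx 1%:M r c H *m block_mx 1%:M (- r) 0 1%:M
  = block_mx (1%:M : 'M_1) 0 c (H - c *m r).
  rewrite mulmx_block !mulmx1 !mul1mx !mulmx0 !addr0 mulmxN.
  by rewrite addNr addrC.
pose Hi := diag_mx (\row_i (h i)^-1).
have HiH : Hi *m H = 1%:M.
  by rewrite mulmx_diag; apply/matrixP => i j; rewrite !mxE mulVf.
have H2 : block_mx 1%:M (- (r *m Hi)) 0 1%:M *m block_mx 1%:M r c H
  = block_mx (1%:M - r *m Hi *m c) (0 : 'M_(1, N)) c H.
  rewrite mulmx_block !mul1mx !mul0mx !add0r !mulNmx; congr (block_mx _ _ _ _).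
  by rewrite -mulmxA HiH mulmx1 subrr.
have e1 := congr1 determinant H1; have e2 := congr1 determinant H2.
move: e1 e2; rewrite !det_mulmx !det_ublock !det_lblock !det1 !mulr1 !mul1r => -> e.
have -> : \matrix_(i, j) (h i *+ (i == j) - v i * v j) = H - c *m r.
  by apply/matrixP => i j; rewrite !mxE big_ord1 !mxE.
rewrite e mulrC det_diag; congr (_ * _); first by apply: eq_bigr => i _; rewrite mxE.
rewrite det_mx11 !mxE; congr (_ - _); apply: eq_bigr => i _.
rewrite !mxE (bigD1 i) //= big1 ?addr0 => [|j ij].
  by rewrite !mxE eqxx mulr1n expr2 mulrAC.
by rewrite !mxE (negPf ij) mulr0n mulr0.
Qed.

End CauchyBinet.

(** * Discrete Chebyshev polynomials *)

Section Chebyshev.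
Variable R : numFieldType.
Implicit Types (P k j x : nat).

(* [cheb P k] is the discrete Chebyshev polynomial 3F2(-k, k + 1, -x; 1, 1 - P; 1). *)
Definition cheb_coef k j : R :=
  \prod_(i < j) ((i%:R * (i%:R + 1) - k%:R * (k%:R + 1)) / (i%:R + 1) ^+ 2).

(** This is (-x)_j / (1 - P)_j with the signs cancelled, while [cheb_coef k j] is (-k)_j (k + 1)_j /
    j!^2, because (i - k) (i + k + 1) = i (i + 1) - k (k + 1). *)
Definition ffact_ratio P x j : R :=
  \prod_(i < j) ((x%:R - i%:R) / (P%:R - 1 - i%:R)).

Definition cheb P k x : R := \sum_(j < k.+1) cheb_coef k j * ffact_ratio P x j.

Lemma natS_neq0 k : k%:R + 1 != 0 :> R.
Proof. by rewrite natr1 pnatr_eq0. Qed.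

Lemma cheb_coef0 k : cheb_coef k 0 = 1.
Proof. by rewrite /cheb_coef big_ord0. Qed.

Lemma cheb_coefS k j : (j%:R + 1) ^+ 2 * cheb_coef k j.+1
  = (j%:R * (j%:R + 1) - k%:R * (k%:R + 1)) * cheb_coef k j.
Proof.
rewrite /cheb_coef big_ord_recr /=; move: (natS_neq0 j) => h; by field.
Qed.

Lemma cheb_coef_gt k j : (k < j)%N -> cheb_coef k j = 0.
Proof.
move=> kj; rewrite /cheb_coef (bigD1 (Ordinal kj)) //=; by rewrite subrr !mul0r.
Qed.

(** Equations are derived as linear combinations of known ones; the multipliers are certificates
    that [ring] checks. *)
Lemma eq_comb1 (c a b l r : R) : l = r -> a - b = c * (l - r) -> a = b.
Proof. by move=> ->; rewrite subrr mulr0 => /subr0_eq. Qed.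

Lemma eq_comb2 (c c' a b l r l' r' : R) :
  l = r -> l' = r' -> a - b = c * (l - r) + c' * (l' - r') -> a = b.
Proof. by move=> -> ->; rewrite !subrr !mulr0 addr0 => /subr0_eq. Qed.

Lemma eq_comb3 (c c' c'' a b l r l' r' l'' r'' : R) :
  l = r -> l' = r' -> l'' = r'' ->
  a - b = c * (l - r) + c' * (l' - r') + c'' * (l'' - r'') -> a = b.
Proof. by move=> -> -> ->; rewrite !subrr !mulr0 !addr0 => /subr0_eq. Qed.

Lemma cheb_coef_next k j :
  (k%:R + 1 - j%:R) * cheb_coef k.+1 j = (k%:R + 1 + j%:R) * cheb_coef k j.
Proof.
elim: j => [|j IH]; first by rewrite !cheb_coef0 subr0 addr0.
have h2 : (j%:R + 1) ^+ 2 != 0 :> R by rewrite expf_neq0 // natS_neq0.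
apply: (mulfI h2).
rewrite mulrCA [RHS]mulrCA !cheb_coefS -!natr1.
apply: (eq_comb1 (c := - (k%:R - j%:R) * (k%:R + 2 + j%:R)) IH).
ring.
Qed.

(* Clearing the factor (j + 1)^2 makes these relations valid without side conditions,
   including for j > k. *)
Lemma cheb_coef_up k j : (j%:R + 1) ^+ 2 * cheb_coef k.+1 j.+1
  = - ((k%:R + 2 + j%:R) * (k%:R + 1 + j%:R)) * cheb_coef k j.
Proof.
rewrite cheb_coefS -natr1.
apply: (eq_comb1 (c := - (k%:R + 2 + j%:R)) (cheb_coef_next k j)); ring.
Qed.

Lemma cheb_coef_down k j : (j%:R + 1) ^+ 2 * cheb_coef k j.+1
  = - ((k%:R - j%:R) * (k%:R + 1 - j%:R)) * cheb_coef k.+1 j.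
Proof.
rewrite cheb_coefS.
apply: (eq_comb1 (c := (k%:R - j%:R)) (cheb_coef_next k j)); ring.
Qed.

(** Coefficientwise, the recurrence [cheb_recSS] has the form P A - B with A and B free of P; this
    is A, and [cheb_coef_rec2] is B. *)
Lemma cheb_coef_rec1 k j : (k%:R + 2) * cheb_coef k.+2 j.+1
  = (2 * k%:R + 3) * (cheb_coef k.+1 j.+1 - 2 * cheb_coef k.+1 j)
    - (k%:R + 1) * cheb_coef k j.+1.
Proof.
have h2 : (j%:R + 1) ^+ 2 != 0 :> R by rewrite expf_neq0 // natS_neq0.
apply: (mulfI h2).
have := cheb_coef_up k.+1 j; have := cheb_coef_down k j.
have := cheb_coefS k.+1 j; rewrite -natr1 => e1 e2 e3.
apply: (eq_comb3 (c := - (2 * k%:R + 3)) (c' := k%:R + 1) (c'' := k%:R + 2) e1 e2 e3).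
ring.
Qed.

Lemma cheb_coef_rec2 k j : (k%:R + 2) ^+ 2 * cheb_coef k.+2 j.+1
  = (2 * k%:R + 3) * ((2 * j%:R + 3) * cheb_coef k.+1 j.+1
                      - 2 * (j%:R + 1) * cheb_coef k.+1 j)
    + (k%:R + 1) ^+ 2 * cheb_coef k j.+1.
Proof.
have h2 : (j%:R + 1) ^+ 2 != 0 :> R by rewrite expf_neq0 // natS_neq0.
apply: (mulfI h2).
have := cheb_coef_up k.+1 j; have := cheb_coef_down k j.
have := cheb_coefS k.+1 j; rewrite -natr1 => e1 e2 e3.
apply: (eq_comb3 (c := - (2 * k%:R + 3) * (2 * j%:R + 3)) (c' := - (k%:R + 1) ^+ 2)
  (c'' := (k%:R + 2) ^+ 2) e1 e2 e3).
ring.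
Qed.

Lemma cheb_widen B P k x : (k < B)%N ->
  cheb P k x = \sum_(j < B) cheb_coef k j * ffact_ratio P x j.
Proof.
move=> kB; rewrite /cheb -!(big_mkord xpredT (fun j =>
  cheb_coef k j * ffact_ratio P x j)).
rewrite [RHS](big_cat_nat (n := k.+1)) //= [X in _ + X]big_nat_cond.
by rewrite [X in _ + X]big1 ?addr0 // => j /andP[/andP[kj _] _];
  rewrite cheb_coef_gt ?mul0r.
Qed.

Lemma cheb_widenS B P k x : (k <= B)%N ->
  cheb P k x = 1 + \sum_(j < B) cheb_coef k j.+1 * ffact_ratio P x j.+1.
Proof.
move=> kB; rewrite (@cheb_widen B.+1) // big_ord_recl cheb_coef0.
by rewrite /ffact_ratio big_ord0 mulr1.
Qed.

Lemma natB1_neq0 P j : (j.+1 < P)%N -> P%:R - 1 - j%:R != 0 :> R.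
Proof.
by move=> jP; rewrite -addrA -opprD nat1r subr_eq0 eqr_nat gtn_eqF.
Qed.

Lemma ffact_ratioS P x j : (j < P)%N -> (x < P)%N ->
  (P%:R - 1 - j%:R) * ffact_ratio P x j.+1 = (x%:R - j%:R) * ffact_ratio P x j.
Proof.
(* For j = P - 1 the last factor of [ffact_ratio P x j.+1] divides by 0, but both sides are 0, the
   right one because x <= j. *)
rewrite leq_eqVlt => /predU1P[<-|jP] xP; last first.
  rewrite /ffact_ratio big_ord_recr /=.
  by have h := natB1_neq0 jP; field.
rewrite -natr1 addrK subrr mul0r; move: xP; rewrite ltnS leq_eqVlt.
case/predU1P=> [->|xj]; first by rewrite subrr mul0r.
by rewrite /ffact_ratio (bigD1 (Ordinal xj)) //= subrr !mul0r mulr0.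
Qed.

(** By [ffact_ratioS], x f_j = j f_j + (P - 1 - j) f_(j+1) for f_j = [ffact_ratio P x j]; the part
    with j f_j is then reindexed. *)
Lemma mul_cheb B P k x : (k < P)%N -> (x < P)%N -> (k < B)%N ->
  x%:R * cheb P k x = \sum_(j < B)
    ((j%:R + 1) * cheb_coef k j.+1 + (P%:R - 1 - j%:R) * cheb_coef k j)
       * ffact_ratio P x j.+1.
Proof.
move=> kP xP kB; rewrite (cheb_widen _ _ kB).
have -> : \sum_(j < B) ((j%:R + 1) * cheb_coef k j.+1
      + (P%:R - 1 - j%:R) * cheb_coef k j) * ffact_ratio P x j.+1 =
  \sum_(j < B) j.+1%:R * cheb_coef k j.+1 * ffact_ratio P x j.+1 +
  \sum_(j < B) (P%:R - 1 - j%:R) * cheb_coef k j * ffact_ratio P x j.+1.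
  by rewrite -big_split; apply: eq_bigr => j _; rewrite /= -natr1; ring.
have -> : \sum_(j < B) j.+1%:R * cheb_coef k j.+1 * ffact_ratio P x j.+1 =
          \sum_(j < B) j%:R * cheb_coef k j * ffact_ratio P x j.
  transitivity (\sum_(j < B.+1) j%:R * cheb_coef k j * ffact_ratio P x j).
    by rewrite big_ord_recl /= !mul0r add0r.
  by rewrite big_ord_recr /= cheb_coef_gt // mulr0 mul0r addr0.
rewrite -big_split mulr_sumr; apply: eq_bigr => j _ /=.
have [jk|kj] := leqP j k; last by rewrite cheb_coef_gt // !(mulr0, mul0r) addr0.
have jP : (j < P)%N by lia.
apply: (eq_comb1 (c := - cheb_coef k j) (ffact_ratioS jP xP)); ring.
Qed.

Lemma cheb_recSS P k x : (k.+1 < P)%N -> (x < P)%N ->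
  (k%:R + 2) * (P%:R - 2 - k%:R) * cheb P k.+2 x
  = (2 * k%:R + 3) * (P%:R - 1 - 2 * x%:R) * cheb P k.+1 x
    - (k%:R + 1) * (P%:R + k%:R + 1) * cheb P k x.
Proof.
move=> kP xP; pose B := k.+2.
have hx := @mul_cheb B P k.+1 x kP xP (leqnn _).
have h2 := @cheb_widenS B P k.+2 x (leqnn _).
have h1 := @cheb_widenS B P k.+1 x (leqW (leqnn _)).
have h0 := @cheb_widenS B P k x (leqW (leqW (leqnn _))).
pose S2 := \sum_(j < B) cheb_coef k.+2 j.+1 * ffact_ratio P x j.+1.
pose S1 := \sum_(j < B) cheb_coef k.+1 j.+1 * ffact_ratio P x j.+1.
pose S0 := \sum_(j < B) cheb_coef k j.+1 * ffact_ratio P x j.+1.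
pose X1 := \sum_(j < B) ((j%:R + 1) * cheb_coef k.+1 j.+1
   + (P%:R - 1 - j%:R) * cheb_coef k.+1 j) * ffact_ratio P x j.+1.
have main : (k%:R + 2) * (P%:R - 2 - k%:R) * S2 = (2 * k%:R + 3) * (P%:R - 1) * S1
   - 2 * (2 * k%:R + 3) * X1 - (k%:R + 1) * (P%:R + k%:R + 1) * S0.
  rewrite !mulr_sumr -!sumrB; apply: eq_bigr => j _.
  have r1 := cheb_coef_rec1 k j; have r2 := cheb_coef_rec2 k j.
  apply: (eq_comb2 (c := P%:R * ffact_ratio P x j.+1) (c' := - ffact_ratio P x j.+1) r1
    r2).
  ring.
have e : (2 * k%:R + 3) * (P%:R - 1 - 2 * x%:R) * cheb P k.+1 x
  = (2 * k%:R + 3) * (P%:R - 1) * cheb P k.+1 x - 2 * (2 * k%:R + 3) * (x%:R * cheb P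
    k.+1 x) by ring.
rewrite e hx h2 h1 h0 -/S2 -/S1 -/S0 -/X1.
apply: (eq_comb1 (c := 1) main); ring.
Qed.

Lemma cheb0 P x : cheb P 0 x = 1.
Proof. by rewrite /cheb big_ord1 cheb_coef0 /ffact_ratio big_ord0 mulr1. Qed.

(* For k = P - 1 the junk value [cheb P P x] comes with coefficient 0. *)
Lemma cheb_rec P k x : (k < P)%N -> (x < P)%N ->
  (2 * k%:R + 1) * (P%:R - 1 - 2 * x%:R) * cheb P k x
  = (k%:R + 1) * (P%:R - 1 - k%:R) * cheb P k.+1 x
    + k%:R * (P%:R + k%:R) * cheb P k.-1 x.
Proof.
case: k => [|k] kP xP; last first.
  apply: (eq_comb1 (c := -1) (cheb_recSS kP xP)); rewrite /= -natr1; ring.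
rewrite cheb0 mul0r /cheb 2!big_ord_recr big_ord0 /= /cheb_coef big_ord_recr !big_ord0 /=.
have := ffact_ratioS kP xP; rewrite {2}/ffact_ratio {2}/ffact_ratio !big_ord0 => e.
by apply: (eq_comb1 (c := 2) e); field.
Qed.

(** The hockey-stick identity for falling factorials. *)
Lemma sum_ffact_ratio P j : (j < P)%N ->
  (j%:R + 1) * \sum_(x < P) ffact_ratio P x j = P%:R.
Proof.
move=> jP.
have key Q : (j%:R + 1) * \sum_(x < Q) \prod_(i < j) (x%:R - i%:R)
             = \prod_(i < j.+1) (Q%:R - i%:R) :> R.
  elim: Q => [|Q IH].
    by rewrite big_ord0 mulr0 big_ord_recl /= subrr mul0r.
  rewrite big_ord_recr mulrDr IH /= big_ord_recr [RHS]big_ord_recl /= subr0.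
  have -> : \prod_(i < j) (Q.+1%:R - (bump 0 i)%:R) = \prod_(i < j) (Q%:R - i%:R) :> R.
    by apply: eq_bigr => i _; rewrite /bump leq0n add1n -!natr1; ring.
  rewrite -natr1; ring.
have hd : \prod_(i < j) (P%:R - 1 - i%:R) != 0 :> R.
  by apply/prodf_neq0 => i _; apply: natB1_neq0; have := ltn_ord i; lia.
have -> : \sum_(x < P) ffact_ratio P x j
    = (\sum_(x < P) \prod_(i < j) (x%:R - i%:R)) / \prod_(i < j) (P%:R - 1 - i%:R).
  rewrite mulr_suml; apply: eq_bigr => x _; rewrite /ffact_ratio.
  by rewrite big_split /= prodfV.
rewrite mulrA key big_ord_recl subr0.
apply: (canLR (mulfK _)) => //; congr (_ * _).
by apply: eq_bigr => i _; rewrite /= /bump leq0n add1n -natr1; ring.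
Qed.

(* Gosper: [cheb_coef k j / (j + 1)] is the difference of
   [- j * cheb_coef k j / (k (k + 1))]. *)
Lemma sum_cheb P k : (0 < k < P)%N -> \sum_(x < P) cheb P k x = 0.
Proof.
move=> /andP[k0 kP]; rewrite /cheb exchange_big /=.
have part J : (J <= k.+1)%N -> k%:R * (k%:R + 1) *
   \sum_(j < J) \sum_(x < P) cheb_coef k j * ffact_ratio P x j
     = - (P%:R * (J%:R * cheb_coef k J)).
  elim: J => [|J IH] JP; first by rewrite big_ord0 mulr0 mul0r mulr0 oppr0.
  rewrite big_ord_recr mulrDr IH /=; last by lia.
  have h := natS_neq0 J.
  rewrite -mulr_sumr; apply: (mulfI h).
  have jP : (J < P)%N by lia.
  have := sum_ffact_ratio jP; set S := \sum_(_ < P) _ => e1.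
  have := cheb_coefS k J => e2; rewrite -natr1.
  apply: (eq_comb2 (c := k%:R * (k%:R + 1) * cheb_coef k J) (c' := P%:R) e1 e2); ring.
have := part k.+1 (leqnn _); rewrite cheb_coef_gt // !mulr0 oppr0 => /eqP.
rewrite mulf_eq0 mulf_eq0 (negPf (natS_neq0 _)) orbF pnatr_eq0.
by rewrite eqn0Ngt k0 /= => /eqP.
Qed.

Definition cheb_dot P i k : R := \sum_(x < P) cheb P i x * cheb P k x.

Lemma cheb_dotC P i k : cheb_dot P i k = cheb_dot P k i.
Proof. by apply: eq_bigr => x _; rewrite mulrC. Qed.

(** Multiplication by P - 1 - 2 x is symmetric for the inner product; the recurrence is applied to
    either factor. *)
Lemma cheb_dot_rec P i k : (i < P)%N -> (k < P)%N ->
  (2 * k%:R + 1) * ((i%:R + 1) * (P%:R - 1 - i%:R) * cheb_dot P i.+1 k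
    + i%:R * (P%:R + i%:R) * cheb_dot P i.-1 k)
  = (2 * i%:R + 1) * ((k%:R + 1) * (P%:R - 1 - k%:R) * cheb_dot P i k.+1
    + k%:R * (P%:R + k%:R) * cheb_dot P i k.-1).
Proof.
move=> iP kP; rewrite !mulr_sumr -!big_split !mulr_sumr; apply: eq_bigr => x _ /=.
have e1 := cheb_rec iP (ltn_ord x); have e2 := cheb_rec kP (ltn_ord x).
apply: (eq_comb2 (c := - (2 * k%:R + 1) * cheb P k x)
  (c' := (2 * i%:R + 1) * cheb P i x) e1 e2); ring.
Qed.

(* By the recurrence, orthogonality reduces to [sum_cheb]. *)
Lemma cheb_orth P i k : (i < k < P)%N -> cheb_dot P i k = 0.
Proof.
suff H : forall i, (forall k, (i < k < P)%N -> cheb_dot P i k = 0) /\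
                   (forall k, (i.+1 < k < P)%N -> cheb_dot P i.+1 k = 0).
  by move=> ikP; apply: (H i).1.
have step j : (forall k, (0 < j)%N -> (j.-1 < k < P)%N -> cheb_dot P j.-1 k = 0) ->
  (forall k, (j < k < P)%N -> cheb_dot P j k = 0) ->
  forall k, (j.+1 < k < P)%N -> cheb_dot P j.+1 k = 0.
  move=> h1 h2 m /andP[jm mP].
  have jP : (j < P)%N by lia.
  have := cheb_dot_rec jP mP.
  rewrite (h2 m.-1) ?mulr0; last by lia.
  have -> : j%:R * (P%:R + j%:R) * cheb_dot P j.-1 m = 0.
    case: j h1 jm {h2 jP} => [|j] h1 jm; first by rewrite !mul0r.
    by rewrite h1 ?mulr0 //=; lia.
  have -> : (m%:R + 1) * (P%:R - 1 - m%:R) * cheb_dot P j m.+1 = 0.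
    have [mP'|mP'] := ltnP m.+1 P; first by rewrite h2 ?mulr0 //; lia.
    have -> : P = m.+1 by lia.
    by rewrite -natr1 addrK subrr mulr0 mul0r.
  rewrite !addr0 mulr0 => /eqP; rewrite !mulf_eq0 (negPf (natS_neq0 _)) /=.
  have -> : (2 * m%:R + 1 == 0 :> R) = false.
    by apply/negbTE; rewrite -natrM natS_neq0.
  have jP' : (j.+1 < P)%N by lia.
  by rewrite (negPf (natB1_neq0 jP')) /= => /eqP.
elim=> [|j [IH1 IH2]]; split.
- by move=> m mP; rewrite -[RHS](sum_cheb mP); apply: eq_bigr => x _; rewrite cheb0 mul1r.
- by apply: step => // m mP; rewrite -[RHS](sum_cheb mP); apply: eq_bigr => x _;
  rewrite cheb0 mul1r.
- exact: IH2.
- apply: step => // m _; exact: IH1.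
Qed.

Lemma cheb_norm0 P : cheb_dot P 0 0 = P%:R.
Proof.
rewrite /cheb_dot (eq_bigr (fun=> 1)) => [|x _]; last by rewrite cheb0 mulr1.
by rewrite sumr_const card_ord.
Qed.

(** This is [cheb_dot_rec] for the indices k and k + 1, where orthogonality or a zero coefficient
    kills the two outer terms. *)
Lemma cheb_normS P k : (k.+1 < P)%N ->
  (2 * k%:R + 3) * (P%:R - 1 - k%:R) * cheb_dot P k.+1 k.+1
  = (2 * k%:R + 1) * (P%:R + k%:R + 1) * cheb_dot P k k.
Proof.
move=> kP; have := cheb_dot_rec (ltnW kP) kP.
have -> : k%:R * (P%:R + k%:R) * cheb_dot P k.-1 k.+1 = 0.
  case: k kP => [|k] kP; first by rewrite !mul0r.
  by rewrite cheb_orth ?mulr0 //=; lia.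
have -> : (k.+1%:R + 1) * (P%:R - 1 - k.+1%:R) * cheb_dot P k k.+2 = 0.
  have [kP'|kP'] := ltnP k.+2 P; first by rewrite cheb_orth ?mulr0 //; lia.
  have -> : P = k.+2 by lia.
  by rewrite -[k.+2%:R]natr1 addrK subrr mulr0 mul0r.
rewrite addr0 add0r /= -natr1 => e.
by apply: (mulfI (natS_neq0 k)); apply: (eq_comb1 (c := 1) e); ring.
Qed.

Lemma cheb_norm_neq0 P k : (k < P)%N -> cheb_dot P k k != 0.
Proof.
elim: k => [|k IH] kP; first by rewrite cheb_norm0 pnatr_eq0; lia.
have := cheb_normS kP => e; apply/eqP => h0; move: e; rewrite h0 mulr0 => /esym/eqP.
rewrite mulf_eq0 (negPf (IH _)) 1?ltnW // orbF -natrM -natrD !natr1 mulf_eq0.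
by rewrite !pnatr_eq0.
Qed.

End Chebyshev.

(** Settles the nonvanishing conditions left by [field]: by hypothesis, by positivity, or by
    contradicting a hypothesis that another quantity is nonzero. *)
Ltac nz := repeat (apply/andP; split); first
  [ assumption | apply: lt0r_neq0; lra
  | match goal with h : is_true (_ != 0) |- _ =>
      apply: (contra_neq _ h) => ?; lra end ].

(** * The kernel next to the center *)

Section Center.
Variable R : realType.
Implicit Types (s n j k h : nat).

Lemma even_neq_odd a b : 2 * a%:R - (2 * b%:R + 1) != 0 :> R.
Proof.
rewrite subr_eq0 -!natrM natr1 eqr_nat; apply/eqP; lia.
Qed.

Lemma nat_neq a b : a <> b -> a%:R - b%:R != 0 :> R.
Proof. by move=> ab; rewrite subr_eq0 eqr_nat; apply/eqP. Qed.

(* The value of [cheb (2 * s) (2 * j)] at s, just above the center of symmetry s - 1/2. *)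
Definition mid_value s j : R :=
  \prod_(i < j) (- ((2 * i%:R + 1) * (s%:R + i%:R + 1))
                 / ((i%:R + 1) * (2 * s%:R - 2 * i%:R - 1))).

Lemma odd_diff_neq0 s i : 2 * s%:R - 2 * i%:R - 1 != 0 :> R.
Proof. by rewrite -addrA -opprD even_neq_odd. Qed.

Lemma mid_valueS s j : (j%:R + 1) * (2 * s%:R - 2 * j%:R - 1) * mid_value s j.+1
  = - ((2 * j%:R + 1) * (s%:R + j%:R + 1)) * mid_value s j.
Proof.
rewrite /mid_value big_ord_recr /=.
have h1 := natS_neq0 R j; have h2 := odd_diff_neq0 s j; field.
by rewrite h1 h2.
Qed.

(** The quadratic factors stem from the difference equation of t_k in x, taken at x = s, where s^2 -
    1 is up to sign the coefficient of t_k(s + 1), and from the symmetry t_k(s - 1) = (-1)^k t_k(s).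
    The proof verifies them by the recurrence in k, in which P - 1 - 2 x is -3. *)
Lemma cheb_center s j : (1 < s)%N -> (j < s)%N ->
  (s%:R ^+ 2 - 1) * cheb R (2 * s) (2 * j) s.+1
    = mid_value s j * (s%:R ^+ 2 - 1 - 2 * j%:R * (2 * j%:R + 1)) /\
  (s%:R ^+ 2 - 1) * (2 * s%:R - 2 * j%:R - 1) * cheb R (2 * s) (2 * j).+1 s.+1
    = - (mid_value s j * (2 * j%:R + 1)
         * (3 * s%:R ^+ 2 - 1 - (2 * j%:R + 1) * (2 * j%:R + 2))).
Proof.
move=> s1; have xs : (s.+1 < 2 * s)%N by lia.
elim: j => [|j IH] js.
  rewrite muln0 cheb0 /mid_value big_ord0; split; first by ring.
  have h : (0 < 2 * s)%N by lia.
  have := @cheb_rec R _ _ _ h xs; rewrite cheb0 !natrM -(natr1 s) => e.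
  apply: (eq_comb1 (c := - (s%:R ^+ 2 - 1)) e); ring.
have {IH} [IH0 IH1] := IH (ltnW js).
have hm := mid_valueS s j.
have k1 : ((2 * j).+1 < 2 * s)%N by lia.
have k2 : ((2 * j).+2 < 2 * s)%N by lia.
have r1 := @cheb_rec R _ _ _ k1 xs; have r2 := @cheb_rec R _ _ _ k2 xs.
have -> : (2 * j.+1 = (2 * j).+2)%N by lia.
move: r1 r2 IH0 IH1.
rewrite /= -?(natr1 (2 * j).+1) -?(natr1 (2 * j)) -?(natr1 s) -?(natr1 j) !natrM.
set q0 := cheb R (2 * s) (2 * j) _; set q1 := cheb R (2 * s) (2 * j).+1 _.
set q2 := cheb R (2 * s) (2 * j).+2 _; set q3 := cheb R (2 * s) (2 * j).+3 _.
move=> r1 r2 IH0 IH1.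
have d0 := natS_neq0 R j; have d1 := odd_diff_neq0 s j.
have d2 : 2 * s%:R - 2 * j%:R - 2 != 0 :> R.
  have -> : 2 * s%:R - 2 * j%:R - 2 = 2 * (s%:R - j.+1%:R) :> R by rewrite -natr1; ring.
  by rewrite mulf_neq0 ?pnatr_eq0 // nat_neq //; lia.
have E2 : (s%:R ^+ 2 - 1) * q2
  = mid_value s j.+1 * (s%:R ^+ 2 - 1 - 2 * (j%:R + 1) * (2 * (j%:R + 1) + 1)).
  have hD : 2 * (j%:R + 1) * (2 * s%:R - 2 * j%:R - 1) * (2 * s%:R - 2 * j%:R - 2) != 0
    :> R.
    by rewrite !mulf_neq0 ?pnatr_eq0.
  apply: (mulfI hD).
  have e1 : (s%:R ^+ 2 - 1) * (2 * s%:R - 2 * j%:R - 1) * ((2 * j%:R + 1 + 1) * (2 *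
    s%:R - 1 - (2 * j%:R + 1)) * q2)
   = - 3 * (2 * (2 * j%:R + 1) + 1) * ((s%:R ^+ 2 - 1) * (2 * s%:R - 2 * j%:R - 1) * q1)
     - (2 * j%:R + 1) * (2 * s%:R + 2 * j%:R + 1) * (2 * s%:R - 2 * j%:R - 1) * ((s%:R
       ^+ 2 - 1) * q0).
    apply: (eq_comb1 (c := - (s%:R ^+ 2 - 1) * (2 * s%:R - 2 * j%:R - 1)) r1); ring.
  rewrite IH0 IH1 in e1.
  apply: (eq_comb2 (c := 1) (c' := - 2 * (2 * s%:R - 2 * j%:R - 2) * (s%:R ^+ 2 - 1 - 2
    * (j%:R + 1) * (2 * (j%:R + 1) + 1))) e1 hm); ring.
split; first exact: E2.
have hD : (2 * j%:R + 3) * (2 * s%:R - 2 * j%:R - 1) != 0 :> R.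
  by rewrite mulf_neq0 // -natrM -natrD pnatr_eq0; lia.
apply: (mulfI hD).
have e1 : (s%:R ^+ 2 - 1) * (2 * s%:R - 2 * j%:R - 1) * ((2 * j%:R + 3) * (2 * s%:R - 2
  * j%:R - 3) * q3)
   = - 3 * (2 * (2 * j%:R + 2) + 1) * (2 * s%:R - 2 * j%:R - 1) * ((s%:R ^+ 2 - 1) * q2)
     - (2 * j%:R + 2) * (2 * s%:R + 2 * j%:R + 2) * ((s%:R ^+ 2 - 1) * (2 * s%:R - 2 *
       j%:R - 1) * q1).
  apply: (eq_comb1 (c := - (s%:R ^+ 2 - 1) * (2 * s%:R - 2 * j%:R - 1)) r2); ring.
rewrite E2 IH1 in e1.
apply: (eq_comb2 (c := 1)
   (c' := 2 * (2 * j%:R + 2) * (3 * s%:R ^+ 2 - 1 - (2 * j%:R + 1) * (2 * j%:R + 2)))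
     e1 hm); ring.
Qed.

(** The kernel summand of degree 2 j at the point s. Those of degrees 2 j and 2 j + 1 at s + 1 are
    rational multiples of it. *)
Definition mid_weight s j : R :=
  mid_value s j ^+ 2 / cheb_dot R (2 * s) (2 * j) (2 * j).

Definition center_kernel s k : R :=
  \sum_(i < k) cheb R (2 * s) i s.+1 ^+ 2 / cheb_dot R (2 * s) i i.

Lemma sqB1_neq0 s : (1 < s)%N -> s%:R ^+ 2 - 1 != 0 :> R.
Proof.
move=> s1; rewrite subr_eq0 -natrX pnatr_eq1; apply/eqP; nia.
Qed.

Lemma cheb_normE s k : (k.+1 < 2 * s)%N ->
  cheb_dot R (2 * s) k.+1 k.+1
  = (2 * k%:R + 1) * (2 * s%:R + k%:R + 1)
    / ((2 * k%:R + 3) * (2 * s%:R - 1 - k%:R)) * cheb_dot R (2 * s) k k.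
Proof.
move=> ks; have := cheb_normS R ks; rewrite natrM => e.
have h1 : 2 * k%:R + 3 != 0 :> R by rewrite -natrM -?natrD ?natr1 pnatr_eq0 ?addnS.
have := @natB1_neq0 R _ _ ks; rewrite natrM => h2.
apply: (mulfI (mulf_neq0 h1 h2)); rewrite e.
by field; rewrite h1 h2.
Qed.

Lemma center_odd s j : (1 < s)%N -> (j < s)%N ->
  cheb R (2 * s) (2 * j).+1 s.+1 ^+ 2 / cheb_dot R (2 * s) (2 * j).+1 (2 * j).+1
  = mid_weight s j * ((2 * j%:R + 1) ^+ 2 * (4 * j%:R + 3)
       * (3 * s%:R ^+ 2 - 1 - (2 * j%:R + 1) * (2 * j%:R + 2)) ^+ 2)
    / ((s%:R ^+ 2 - 1) ^+ 2 * (2 * s%:R - 2 * j%:R - 1)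
        * (4 * j%:R + 1) * (2 * s%:R + 2 * j%:R + 1)).
Proof.
move=> s1 js; have [_ e] := cheb_center s1 js.
have ks : ((2 * j).+1 < 2 * s)%N by lia.
rewrite /mid_weight (cheb_normE ks) !natrM.
have h0 := @cheb_norm_neq0 R _ _ (ltnW ks); have j0 : 0 <= j%:R :> R := ler0n _ _.
have h1 := sqB1_neq0 s1; have h2 := odd_diff_neq0 s j.
have h3 : 4 * j%:R + 3 != 0 :> R by rewrite -natrM -?natrD ?natr1 pnatr_eq0 ?addnS.
have h4 : 4 * j%:R + 1 != 0 :> R by rewrite -natrM -?natrD ?natr1 pnatr_eq0 ?addnS.
have h5 : 2 * s%:R + 2 * j%:R + 1 != 0 :> R by rewrite -!natrM -natrD natr1 pnatr_eq0.
have -> : cheb R (2 * s) (2 * j).+1 s.+1 = - (mid_value s j * (2 * j%:R + 1)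
         * (3 * s%:R ^+ 2 - 1 - (2 * j%:R + 1) * (2 * j%:R + 2))) / ((s%:R ^+ 2 - 1) *
           (2 * s%:R - 2 * j%:R - 1)).
  by rewrite -e; field; rewrite h1 h2.
by field; nz.
Qed.

Lemma center_even s j : (1 < s)%N -> (j < s)%N ->
  cheb R (2 * s) (2 * j) s.+1 ^+ 2 / cheb_dot R (2 * s) (2 * j) (2 * j)
  = mid_weight s j * (s%:R ^+ 2 - 1 - 2 * j%:R * (2 * j%:R + 1)) ^+ 2
      / (s%:R ^+ 2 - 1) ^+ 2.
Proof.
move=> s1 js; have [e _] := cheb_center s1 js.
have ks : (2 * j < 2 * s)%N by lia.
have h0 := @cheb_norm_neq0 R _ _ ks; have h1 := sqB1_neq0 s1.
rewrite /mid_weight -[cheb _ _ _ _](mulKf h1) e.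
by field; nz.
Qed.

Lemma mid_weightS s j : (j.+1 < s)%N ->
  mid_weight s j.+1 = mid_weight s j *
   ((2 * j%:R + 1) ^+ 2 * (s%:R + j%:R + 1) * (4 * j%:R + 5) * (s%:R - 1 - j%:R))
   / ((j%:R + 1) ^+ 2 * (2 * s%:R - 2 * j%:R - 1) * (4 * j%:R + 1)
        * (2 * s%:R + 2 * j%:R + 1)).
Proof.
move=> js; rewrite /mid_weight.
have -> : (2 * j.+1 = (2 * j).+2)%N by lia.
have k1 : ((2 * j).+1 < 2 * s)%N by lia.
have k2 : ((2 * j).+2 < 2 * s)%N by lia.
rewrite (cheb_normE k2) (cheb_normE k1) -(natr1 (2 * j)) !natrM.
have h0 := @cheb_norm_neq0 R _ _ (ltnW k1).
have j0 : 0 <= j%:R :> R := ler0n _ _; have s0 : 0 <= s%:R :> R := ler0n _ _.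
have d1 := odd_diff_neq0 s j.
have d2 : s%:R - 1 - j%:R != 0 :> R.
  by rewrite -addrA -opprD nat1r nat_neq //; lia.
have d4 : 2 * s%:R - 1 - (2 * j%:R + 1) != 0 :> R.
  have -> : 2 * s%:R - 1 - (2 * j%:R + 1) = 2 * (s%:R - 1 - j%:R) :> R by ring.
  by rewrite mulf_neq0 ?pnatr_eq0.
have d3 : j%:R + 1 != 0 :> R := natS_neq0 _ _.
have e : mid_value s j.+1 = - ((2 * j%:R + 1) * (s%:R + j%:R + 1)) * mid_value s j
     / ((j%:R + 1) * (2 * s%:R - 2 * j%:R - 1)).
  by rewrite -mid_valueS; field; rewrite d3 d1.
by rewrite e; field; nz.
Qed.

Lemma center_kernelS s n : (1 < s)%N -> (n.+1 < s)%N ->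
  center_kernel s (2 * n.+1).+1 = center_kernel s (2 * n).+1
   + mid_weight s n * ((2 * n%:R + 1) ^+ 2 * (4 * n%:R + 3)
       * (3 * s%:R ^+ 2 - 1 - (2 * n%:R + 1) * (2 * n%:R + 2)) ^+ 2)
    / ((s%:R ^+ 2 - 1) ^+ 2 * (2 * s%:R - 2 * n%:R - 1)
        * (4 * n%:R + 1) * (2 * s%:R + 2 * n%:R + 1))
   + mid_weight s n.+1
      * (s%:R ^+ 2 - 1 - 2 * (n%:R + 1) * (2 * (n%:R + 1) + 1)) ^+ 2
      / (s%:R ^+ 2 - 1) ^+ 2.
Proof.
move=> s1 ns; rewrite -(center_odd s1 (ltnW ns)) natr1 -(center_even s1 ns).
have -> : (2 * n.+1 = (2 * n).+2)%N by lia.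
by rewrite /center_kernel big_ord_recr [X in X + _ = _]big_ord_recr.
Qed.

(** * The hypergeometric sum and its recurrence in n *)

Definition hyp_coef n h : R := let nu : R := n%:R in
  shifted_factorial 4 h * shifted_factorial (1 - nu) h
    * shifted_factorial (5 / 2 + nu) h
  / (shifted_factorial 1 h * shifted_factorial (4 + nu) h
      * shifted_factorial (5 / 2 - nu) h).

Lemma shifted_factorialS (a : R) k :
  shifted_factorial a k.+1 = shifted_factorial a k * (a + k%:R).
Proof. by rewrite /shifted_factorial big_nat_recr. Qed.

Lemma half_neq0 a n h : odd a -> a%:R / 2 - n%:R + h%:R != 0 :> R.
Proof.
move=> oa; apply/eqP => e.
have : (a + 2 * h)%N%:R = (2 * n)%N%:R :> R by rewrite natrD !natrM; lra.
by move/eqP; rewrite eqr_nat => /eqP; lia.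
Qed.

Lemma hyp_coef0 n : hyp_coef n 0 = 1.
Proof. by rewrite /hyp_coef /shifted_factorial !big_geq // !mulr1 divr1. Qed.

Lemma hyp_coefS n h : hyp_coef n h.+1 = hyp_coef n h *
  ((4 + h%:R) * (1 - n%:R + h%:R) * (5 / 2 + n%:R + h%:R)
   / ((1 + h%:R) * (4 + n%:R + h%:R) * (5 / 2 - n%:R + h%:R))).
Proof.
rewrite /hyp_coef /= !shifted_factorialS !invfM; ring.
Qed.

Lemma hyp_coef_vanish n : hyp_coef n.+1 n.+1 = 0.
Proof.
by rewrite hyp_coefS (_ : 1 - n.+1%:R + n%:R = 0) ?(mulr0, mul0r) // -natr1; ring.
Qed.

(** In the ratio between n and n + 1 each shifted factorial leaves only its end factors. *)
Lemma hyp_coef_shift n h : (0 < n)%N -> 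
  hyp_coef n h * (n%:R * (n%:R + 4) * (h%:R + n%:R + 5 / 2) * (h%:R - n%:R + 3 / 2))
  = hyp_coef n.+1 h * ((n%:R - h%:R) * (n%:R + 4 + h%:R) * (n%:R + 5 / 2) * (3 / 2 -
    n%:R)).
Proof.
move=> n0; have n1 : 1 <= n%:R :> R by rewrite ler1n.
elim: h => [|h IH]; first by rewrite !hyp_coef0; ring.
rewrite !hyp_coefS -(natr1 n) -(natr1 h).
have h0 : 0 <= h%:R :> R := ler0n _ _.
have d5 := @half_neq0 5 n h isT; have d3 := @half_neq0 3 n h isT.
have e : hyp_coef n h = hyp_coef n.+1 h * ((n%:R - h%:R) * (n%:R + 4 + h%:R) * (n%:R +
  5 / 2) * (3 / 2 - n%:R)) / (n%:R * (n%:R + 4) * (h%:R + n%:R + 5 / 2) * (h%:R - n%:R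
  + 3 / 2)).
  by rewrite -IH; field; nz.
by rewrite e; field; nz.
Qed.

(* The right-hand side is the antidifference found by Gosper's algorithm. *)
Lemma sum_hyp_coef n H :
  \sum_(h < H) hyp_coef n.+1 h / ((h%:R + n%:R + 5 / 2) * (h%:R - n%:R + 3 / 2))
  = (1 - 2 * n%:R) * (n%:R + 3) * (n%:R + 4) / (9 * (2 * n%:R + 5))
    - hyp_coef n.+1 H * ((H%:R + 3 / 2) ^+ 2 - 2 / 3 * ((n%:R + 1 / 2) * (n%:R + 2) + 7
      / 8))
       * (n%:R + 4 + H%:R)
      / ((H%:R + n%:R + 5 / 2) * (H%:R + 1) * (H%:R + 2) * (H%:R + 3)).
Proof.
have n0 : 0 <= n%:R :> R := ler0n _ _.
elim: H => [|H IH]; first by rewrite big_ord0 hyp_coef0; field; nz.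
rewrite big_ord_recr IH /= hyp_coefS -(natr1 n) -(natr1 H).
have h0 : 0 <= H%:R :> R := ler0n _ _.
have d3 := @half_neq0 3 n H isT.
by field; nz.
Qed.

(* The factor (s - n - 1) / (s - 2 - h) is 1 for h = n - 1, also when s = n + 1 (that is,
   m = 1), where it would read 0 / 0. *)
Definition kernel_sum s n : R :=
  \sum_(h < n) (if h.+1 == n then 1 else (s%:R - n%:R - 1) / (s%:R - 2 - h%:R))
     * hyp_coef n h / (s%:R + 2 + h%:R).

(** For s = n + m this is [prefactor R n m] (see [prefactorE]) times 24 n (2 n + m + 1) (2 n + 3),
    the coefficient of the regularized sum. *)
Definition kernel_scale s n : R :=
  24 * s%:R ^+ 2 * n%:R * (n%:R + s%:R + 1) * (2 * n%:R + 1) * (2 * n%:R + 3)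
   * mid_weight s n
  / ((s%:R ^+ 2 - 1) * (2 * n%:R - 1) * (2 * n%:R - 3) * (n%:R + 1)
      * (n%:R + 2) * (n%:R + 3) * (4 * n%:R + 1)).

Lemma kernel_scaleS s n : (0 < n)%N -> (n.+1 < s)%N ->
  kernel_scale s n.+1 = kernel_scale s n *
   ((n%:R + s%:R + 2) * (2 * n%:R + 5) * (2 * n%:R - 3) * (s%:R - 1 - n%:R))
   / (n%:R * (n%:R + 4) * (2 * s%:R - 2 * n%:R - 1) * (2 * s%:R + 2 * n%:R + 1)).
Proof.
move=> n0 ns; rewrite /kernel_scale mid_weightS // -(natr1 n).
have h1 : 1 <= n%:R :> R by rewrite ler1n.
have s0 : 0 <= s%:R :> R := ler0n _ _.
have d1 := odd_diff_neq0 s n.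
have d2 : s%:R ^+ 2 - 1 != 0 :> R by apply: sqB1_neq0; lia.
have d3 := @even_neq_odd n 1.
by field; nz.
Qed.

(* [kernel_scale] is normalized so that the residue of the summand at h = s - 2 does not
   depend on n: the poles cancel in the difference, and [sum_hyp_coef] applies. *)
Lemma kernel_sumS s n : (0 < n)%N -> (n.+1 < s)%N ->
  kernel_scale s n.+1 * kernel_sum s n.+1 = kernel_scale s n * kernel_sum s n
    + kernel_scale s n.+1 * (4 * n%:R + 5) * (1 - 2 * n%:R) * (n%:R + 3) * (n%:R + 4)
      / (12 * (s%:R + n%:R + 2) * (2 * n%:R + 5)).
Proof.
move=> n0 ns.
have h1 : 1 <= n%:R :> R by rewrite ler1n.
have s0 : 0 <= s%:R :> R := ler0n _ _.
(* The factor, free of h, that is left of the difference of the scaled summands after the poles at h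
   = s - 2 and h = - s - 2 have cancelled. *)
pose kap : R := kernel_scale s n.+1 * 3 * (4 * n%:R + 5) / (4 * (s%:R + n%:R + 2)).
have tele := sum_hyp_coef n n.+1.
rewrite hyp_coef_vanish !mul0r subr0 in tele.
pose T n h := (if h.+1 == n then 1 else (s%:R - n%:R - 1) / (s%:R - 2 - h%:R))
     * hyp_coef n h / (s%:R + 2 + h%:R).
have Tnn : T n n = 0.
  rewrite /T; case: n n0 {ns h1 kap tele T} => // n _.
  by rewrite hyp_coef_vanish mulr0 mul0r.
have -> : kernel_sum s n = \sum_(h < n.+1) T n h.
  by rewrite big_ord_recr /= Tnn addr0.
rewrite -[kernel_sum _ _]/(\sum_(h < n.+1) T n.+1 h).
apply/eqP; rewrite -subr_eq0 opprD addrA subr_eq0; apply/eqP.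
transitivity (kap * \sum_(h < n.+1) hyp_coef n.+1 h / ((h%:R + n%:R + 5 / 2) * (h%:R -
  n%:R + 3 / 2))); last first.
  by rewrite tele /kap; field; nz.
rewrite !mulr_sumr -sumrB; apply: eq_bigr => h _.
have h0 : 0 <= h%:R :> R := ler0n _ _.
have d3 := @half_neq0 3 n h isT.
have [hn|hn] := ltnP h n; last first.
  have -> : h = n :> nat by have := ltn_ord h; lia.
  by rewrite Tnn mulr0 subr0 /T eqxx /kap; field; nz.
have e := hyp_coef_shift h n0.
have dn : n%:R * (n%:R + 4) * (h%:R + n%:R + 5 / 2) * (h%:R - n%:R + 3 / 2) != 0 :> R.
  by rewrite !mulf_neq0 //; nz.
have -> : T n h = (s%:R - n%:R - 1) / (s%:R - 2 - h%:R) * (hyp_coef n.+1 h *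
   ((n%:R - h%:R) * (n%:R + 4 + h%:R) * (n%:R + 5 / 2) * (3 / 2 - n%:R))
   / (n%:R * (n%:R + 4) * (h%:R + n%:R + 5 / 2) * (h%:R - n%:R + 3 / 2))) / (s%:R + 2 +
     h%:R).
  rewrite -e (mulfK dn) /T; case: eqP => // hn1.
  have -> : s%:R - 2 - h%:R = s%:R - n%:R - 1 :> R 
    by have E : h%:R + 1 = n%:R :> R; [rewrite natr1 hn1 | lra].
  rewrite divff //; rewrite -addrA -opprD natr1 nat_neq //; lia.
rewrite /T ltn_eqF // /kap kernel_scaleS // -(natr1 n).
have d1 := odd_diff_neq0 s n.
have d4 : s%:R - 2 - h%:R != 0 :> R.
  by rewrite -addrA -opprD -natrD nat_neq //; lia.
by field; nz.
Qed.

(** Induction on n with s fixed. The two new degrees, the correction in [kernel_sumS] and the change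
    of the Y term are all rational multiples of [mid_weight s n], so each step is a rational
    identity. *)
Lemma center_kernelE s n : (0 < n)%N -> (n < s)%N ->
  center_kernel s (2 * n).+1
  = mid_weight s n * (2 * n%:R + 1) * Ypoly (s%:R - n%:R) n%:R
     / ((s%:R ^+ 2 - 1) ^+ 2 * (n%:R + 1) * (4 * n%:R + 1))
    - kernel_scale s n * kernel_sum s n.
Proof.
have s0 : 0 <= s%:R :> R := ler0n _ _.
elim: n => // -[_ _ s1|n IH _ ns].
  rewrite center_kernelS //.
  have -> : center_kernel s (2 * 0).+1 = mid_weight s 0.
    by rewrite muln0 /center_kernel big_ord1 cheb0 /mid_weight /mid_value big_ord0.
  rewrite /kernel_scale /kernel_sum big_ord1 /= hyp_coef0 mid_weightS // /Ypoly.
  have d1 := odd_diff_neq0 s 0.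
  have d2 : s%:R ^+ 2 - 1 != 0 :> R by apply: sqB1_neq0; lia.
  by field; nz.
rewrite center_kernelS //; last by lia.
rewrite IH //; last by lia.
rewrite [kernel_scale s n.+2 * _]kernel_sumS // /kernel_scale [mid_weight s
  n.+2]mid_weightS // /Ypoly -(natr1 n.+1).
set nu : R := n.+1%:R.
have h1 : 1 <= nu by rewrite ler1n.
have d1 : 2 * s%:R - 2 * nu - 1 != 0 := odd_diff_neq0 s n.+1.
have d2 : s%:R ^+ 2 - 1 != 0 :> R by apply: sqB1_neq0; lia.
have d3 : 2 * nu - (2 * 1 + 1) != 0 :> R := @even_neq_odd n.+1 1.
have n0 : 0 <= n%:R :> R := ler0n _ _.
move: d1 d3; rewrite /nu -natr1 => d1 d3.
by field; nz.
Qed.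

(** * The binomial prefactor as a rational multiple of [mid_weight] *)

Lemma central_binS a :
  'C(2 * a.+1, a.+1)%:R = 'C(2 * a, a)%:R * (2 * (2 * a%:R + 1) / (a%:R + 1)) :> R.
Proof.
have e1 : (a.+1 * 'C((2 * a).+1, a) = (2 * a).+1 * 'C(2 * a, a))%N.
  by rewrite [RHS](mul_bin_down (2 * a).+1); congr (_ * _)%N; lia.
have e2 := mul_bin_diag (2 * a).+1 a.
have e3 : (a.+1 * 'C(2 * a.+1, a.+1) = 2 * ((2 * a).+1 * 'C(2 * a, a)))%N.
  by rewrite (_ : 2 * a.+1 = (2 * a).+2)%N; [rewrite -mul_bin_diag /= -e1; lia | lia].
have a0 : 0 <= a%:R :> R := ler0n _ _.
have := congr1 (fun k => k%:R : R) e3;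
  rewrite !natrM -(natr1 (2 * a)) -(natr1 a) natrM => e.
apply: (@mulfI _ (a%:R + 1)); first by nz.
by rewrite e; field; nz.
Qed.

Lemma half_central_bin a : (0 < a)%N -> 'C(2 * a - 1, a)%:R = 'C(2 * a, a)%:R / 2 :> R.
Proof.
move=> a_gt0; have := mul_bin_down (2 * a) a.
rewrite -subn1 (_ : 2 * a - a = a)%N; last by lia.
rewrite -mulnA mulnCA => /eqP; rewrite eqn_pmul2l // => /eqP <-.
by rewrite natrM mulrC mulKf ?pnatr_eq0.
Qed.

(** One unit is traded from m to n, so that s = n + m stays fixed as in [mid_weightS]; this drives
    the induction for [prefactorE]. *)
Lemma prefactorS n m : (0 < n)%N -> (0 < m)%N -> prefactor R n.+1 m = prefactor R n m.+1 *
  (m%:R * (2 * n%:R + 3) * (2 * n%:R + m%:R + 2) * (2 * n%:R - 3))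
  / ((2 * m%:R + 1) * (n%:R + 1) * (n%:R + 4) * (4 * n%:R + 2 * m%:R + 3)).
Proof.
move=> n_gt0 m_gt0; rewrite /prefactor.
have -> : (4 * n.+1 + 2 * m = 2 * (2 * n + m.+1).+1)%N by lia.
have -> : (4 * n + 2 * m.+1 = 2 * (2 * n + m.+1))%N by lia.
have -> : (2 * n.+1 + m = (2 * n + m.+1).+1)%N by lia.
have -> : (n.+1 + m - 1 = n + m)%N by lia.
have -> : (n + m.+1 - 1 = n + m)%N by lia.
have -> : (m.+1 - 1 = m)%N by lia.
have -> : (n.+1 - 1 = n)%N by lia.
have e1 : (m * 'C(n + m, m) = n.+1 * 'C(n + m, m - 1))%N.
  have := mul_bin_left (n + m) m.-1; rewrite (prednK m_gt0) subn1 => ->.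
  by congr (_ * _)%N; lia.
have e2 : (n * (n + 4) * 'C(2 * n.+1 + 2, n)
    = (2 * n + 4) * (2 * n + 3) * 'C(2 * n + 2, n - 1))%N.
  have e : ((2 * n + 3) * 'C(2 * n + 2, n - 1) = (n + 4) * 'C(2 * n + 3, n - 1))%N.
    have -> : (2 * n + 2 = (2 * n + 3).-1)%N by lia.
    by rewrite mul_bin_down; congr (_ * _)%N; lia.
  rewrite -!mulnA e (_ : 2 * n + 3 = (2 * n.+1 + 2).-1)%N; last by lia.
  rewrite mulnCA (_ : 2 * n + 4 = 2 * n.+1 + 2)%N; last by lia.
  by rewrite [RHS]mulnCA mul_bin_diag subn1 (prednK n_gt0).
move NE: (2 * n + m.+1)%N => N.
have e3 : ((n + 2) * 'C(N.+1, n.+1 + 1) = N.+1 * 'C(N, n + 1))%N.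
  by rewrite [RHS](mul_bin_diag N.+1) !addn1 addn2.
have e4 : (2 * n * (2 * n - 1) * 'C(N.+1, m + 2) = N.+1 * (m + 3) * 'C(N, m.+1 + 2))%N.
  have := mul_bin_down N.+1 (m + 3); have := mul_bin_left N.+1 (m + 2).
  rewrite /= !addnS !addn0 => eL eD.
  rewrite (_ : N.+1 * _ * _ = m.+3 * (N.+1 * 'C(N, m.+3)))%N; last by lia.
  rewrite eD mulnCA eL mulnA; congr (_ * _)%N.
  by rewrite mulnC; congr (_ * _)%N; lia.
have ratio a b c d : (0 < a)%N -> (a * b = c * d)%N -> b%:R = c%:R / a%:R * d%:R :> R.
  move=> a_gt0 /(congr1 (fun k => k%:R : R)); rewrite !natrM mulrAC => <-.
  by rewrite mulrC mulKf // pnatr_eq0 -lt0n.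
have n1 : 1 <= n%:R :> R by rewrite ler1n.
have m1 : 1 <= m%:R :> R by rewrite ler1n.
have C1 : 'C(N, m.+1 + 2)%:R != 0 :> R by rewrite pnatr_eq0 -lt0n bin_gt0; lia.
have C2 : 'C(2 * N, N)%:R != 0 :> R by rewrite pnatr_eq0 -lt0n bin_gt0; lia.
have d := even_neq_odd n 1.
rewrite !natrM !central_binS !half_central_bin // central_binS.
rewrite (ratio _ _ _ _ m_gt0 e1) (ratio _ _ _ _ _ e2); last by lia.
rewrite (ratio _ _ _ _ _ e3) ?(ratio _ _ _ _ _ e4); try nia.
rewrite [(2 * n * (2 * n - 1))%:R]natrM natrB ?natrM; last by lia.
have -> : N%:R = 2 * n%:R + m%:R + 1 :> R by rewrite -NE; ring.
have -> : N.+1%:R = 2 * n%:R + m%:R + 2 :> R by rewrite -NE; ring.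
by field; nz.
Qed.

Lemma prefactorE n m : (0 < n)%N -> (0 < m)%N ->
  prefactor R n m = (n + m)%:R ^+ 2 * (2 * n%:R + 1) * mid_weight (n + m) n
   / (((n + m)%:R ^+ 2 - 1) * (2 * n%:R - 1) * (2 * n%:R - 3) * (n%:R + 1)
       * (n%:R + 2) * (n%:R + 3) * (4 * n%:R + 1)).
Proof.
elim: n m => // -[_ m _|n IH m _] m0.
  have m1 : 1 <= m%:R :> R by rewrite ler1n.
  rewrite add1n mid_weightS // /mid_weight muln0 cheb_norm0 /mid_value big_ord0.
  rewrite /prefactor add1n (_ : m.+1 - 1 = m)%N; last by lia.
  rewrite (_ : 'C(m, m - 1) = m); last by rewrite bin_sub // bin1.
  rewrite (_ : 'C(2 * 1 + 2, 1 - 1) = 1%N) // (_ : 2 * 1 + m = m.+2)%N; last by lia.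
  rewrite (_ : 4 * 1 + 2 * m = 2 * m.+2)%N; last by lia.
  rewrite addn2 binn !muln1 mul1n !natrM half_central_bin // !central_binS.
  have -> : 'C(m.+2, 2)%:R = (m%:R + 2) * (m%:R + 1) / 2 :> R.
    have e : (m.+2 * m.+1 = 2 * 'C(m.+2, 2))%N by rewrite -mul_bin_diag bin1.
    by apply: (mulfI (x := 2)); [nz | rewrite -natrM -e natrM; field].
  have C0 : 'C(2 * m, m)%:R != 0 :> R by rewrite pnatr_eq0 -lt0n bin_gt0; lia.
  have d : (1 + m%:R) ^+ 2 - 1 != 0 :> R by rewrite nat1r sqB1_neq0.
  by field; nz.
rewrite prefactorS // IH // (addSnnS n.+1) [mid_weight _ n.+2]mid_weightS; last by lia.
have n0 : 0 <= n%:R :> R := ler0n _ _; have m1 : 1 <= m%:R :> R by rewrite ler1n.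
have d1 := odd_diff_neq0 (n.+1 + m.+1) n.+1.
have d2 : (1 + n%:R + (1 + m%:R)) ^+ 2 - 1 != 0 :> R.
  by rewrite !nat1r -natrD sqB1_neq0 //; lia.
have d3 := even_neq_odd n 0.
by field; nz.
Qed.

(** * The partition functions *)

Definition bin_fun P (i : nat) (x : 'I_P) : R := 'C(x, i)%:R.

Definition cheb_fun P (k : nat) (x : 'I_P) : R := cheb R P k x.

(** The coefficient of binomial(x, k) in [cheb P k]. *)
Definition cheb_unit P k : R := cheb_coef R k k * k`!%:R / ((P - 1) ^_ k)%:R.

Lemma ffact_prod x j : (x ^_ j)%:R = \prod_(i < j) (x%:R - i%:R) :> R.
Proof.
elim: j => [|j IH]; first by rewrite big_ord0.
rewrite big_ord_recr -IH /= ffactnSr natrM.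
have [jx|xj] := leqP j x; first by rewrite natrB.
by rewrite ffact_small // !mul0r.
Qed.

Lemma ffact_ratioE P x j : (j < P)%N ->
  ffact_ratio R P x j = 'C(x, j)%:R * (j`!%:R / ((P - 1) ^_ j)%:R).
Proof.
move=> jP; rewrite mulrA -natrM bin_ffact !ffact_prod /ffact_ratio.
rewrite big_split /= prodfV; congr (_ / _); apply: eq_bigr => i _.
by rewrite natrB //; lia.
Qed.

(** The change from binomials to Chebyshev polynomials is triangular. Only degrees below #|X| <= P
    occur, so no denominator vanishes. *)
Lemma set_det_cheb P (X : {set 'I_P}) :
  set_det (@cheb_fun P) X = (\prod_(k < #|X|) cheb_unit P k) * set_det (@bin_fun P) X.
Proof.
have XP : (#|X| <= P)%N by rewrite -[P in (_ <= P)%N]card_ord max_card.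
pose U := \matrix_(k < #|X|, j < #|X|) (cheb_coef R k j * (j`!%:R / ((P - 1) ^_ j)%:R)).
have -> : \prod_(k < #|X|) cheb_unit P k = \det U^T.
  rewrite det_tr det_trig; last by apply/is_trig_mxP => i j ij;
    rewrite mxE cheb_coef_gt ?mul0r.
  by apply: eq_bigr => i _; rewrite mxE mulrA.
rewrite mulrC -det_mulmx; congr (\det _); apply/matrixP => i k.
rewrite !mxE /cheb_fun (@cheb_widen _ #|X|) //; apply: eq_bigr => j _.
by rewrite !mxE ffact_ratioE 1?mulrCA //; exact: leq_trans XP.
Qed.

Lemma cheb_gram P N : (N <= P)%N ->
  \matrix_(i < N, j < N) (\sum_(x : 'I_P) 1 * cheb_fun i x * cheb_fun j x)
  = diag_mx (\row_(i < N) cheb_dot R P i i).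
Proof.
move=> NP; apply/matrixP => i j; rewrite !mxE.
transitivity (cheb_dot R P i j).
  by apply: eq_bigr => x _; rewrite mul1r.
have [->|ij] := eqVneq i j; first by rewrite mulr1n.
have [ltij|ltji|/val_inj eij] := ltngtP i j; last by rewrite eij eqxx in ij.
  by rewrite cheb_orth // ltij (leq_trans (ltn_ord j)).
by rewrite cheb_dotC cheb_orth // ltji (leq_trans (ltn_ord i)).
Qed.

(* The squared norm of the multiple of [cheb P k] with leading term binomial(x, k). *)
Definition monic_norm P k : R := cheb_dot R P k k / cheb_unit P k ^+ 2.

Lemma cheb_coef_diag_neq0 k : cheb_coef R k k != 0.
Proof.
elim: k => [|k IH]; first by rewrite cheb_coef0 oner_neq0.
have := cheb_coef_up R k k => e; apply/eqP => h0; move: e; rewrite h0 mulr0.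
move/esym/eqP; rewrite mulf_eq0 (negPf IH) orbF oppr_eq0 mulf_eq0.
have k0 : 0 <= k%:R :> R := ler0n _ _.
by case/orP; apply/negP; apply: lt0r_neq0; lra.
Qed.

Lemma cheb_unit_neq0 P k : (k < P)%N -> cheb_unit P k != 0.
Proof.
move=> kP; rewrite /cheb_unit !mulf_neq0 ?cheb_coef_diag_neq0 ?invr_neq0 //.
  by rewrite pnatr_eq0 -lt0n fact_gt0.
by rewrite pnatr_eq0 -lt0n ffact_gt0; lia.
Qed.

Lemma sum_sqr_set_det P N : (N <= P)%N ->
  \sum_(X : {set 'I_P} | #|X| == N) set_det (@bin_fun P) X ^+ 2
  = \prod_(k < N) monic_norm P k.
Proof.
move=> NP; pose u := \prod_(k < N) cheb_unit P k ^+ 2.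
have u0 : u != 0.
  by apply/prodf_neq0 => k _; rewrite expf_neq0 // cheb_unit_neq0 // (leq_trans
    (ltn_ord k)).
apply: (mulfI u0); rewrite -big_split /= mulr_sumr.
have := cauchy_binet N (@cheb_fun P) (fun=> 1); rewrite cheb_gram // det_diag => e.
transitivity (\prod_(k < N) cheb_dot R P k k); last first.
  apply: eq_bigr => k _; rewrite /monic_norm mulrC divfK // expf_neq0 //.
  by rewrite cheb_unit_neq0 // (leq_trans (ltn_ord k)).
transitivity (\prod_(i < N) (\row_(i < N) cheb_dot R P i i) 0 i); last first.
  by apply: eq_bigr => k _; rewrite mxE.
rewrite -e; apply: eq_bigr => X /eqP cX.
by rewrite big1 // mul1r set_det_cheb cX exprMn -prodrXl.
Qed.

(** The sets that avoid l are subtracted from the total; the weight vanishing only at l selects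
    them, and [det_diag_sub_outer] evaluates its Gram determinant. *)
Lemma sum_sqr_set_det_mem P N (l : 'I_P) : (N <= P)%N ->
  \sum_(X : {set 'I_P} | (#|X| == N) && (l \in X)) set_det (@bin_fun P) X ^+ 2
  = (\prod_(k < N) monic_norm P k)
    * \sum_(k < N) cheb R P k l ^+ 2 / cheb_dot R P k k.
Proof.
move=> NP; pose u := \prod_(k < N) cheb_unit P k ^+ 2.
have u0 : u != 0.
  by apply/prodf_neq0 => k _; rewrite expf_neq0 // cheb_unit_neq0 // (leq_trans
    (ltn_ord k)).
have tot := sum_sqr_set_det NP.
rewrite (bigID (fun X : {set 'I_P} => l \in X)) /= in tot.
apply: (addIr (\sum_(i : {set 'I_P} | (#|i| == N) && (l \notin i)) set_det (@bin_fun P)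
  i ^+ 2)).
rewrite tot -[LHS]mulr1 -[X in _ * X
  = _](subrK (\sum_(k < N) cheb R P k l ^+ 2 / cheb_dot R P k k) 1).
rewrite mulrDr addrC; congr (_ + _).
apply: (mulfI u0).
have := cauchy_binet N (@cheb_fun P) (fun x => (x != l)%:R).
have -> : \matrix_(i < N, j < N) (\sum_(x : 'I_P) (x != l)%:R * cheb_fun i x * cheb_fun
  j x)
   = \matrix_(i < N, j < N) (cheb_dot R P i i *+ (i == j) - cheb R P i l * cheb R P j l).
  have := cheb_gram NP => /matrixP G; apply/matrixP => i j; have := G i j.
  rewrite !mxE (bigD1 l) //= => <-; rewrite [LHS](bigD1 l) //= eqxx !mul0r add0r mul1r.
  rewrite addrAC subrr add0r; apply: eq_bigr => x -> //.
rewrite (det_diag_sub_outer (h := fun i : 'I_N => cheb_dot R P i i) (fun i : 'I_N =>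
  cheb R P i l)); last first.
  by move=> i; rewrite cheb_norm_neq0 // (leq_trans (ltn_ord i)).
move=> e; transitivity ((\prod_(i < N) cheb_dot R P i i) *
   (1 - \sum_(k < N) cheb R P k l ^+ 2 / cheb_dot R P k k)).
  rewrite mulrA -big_split /=; congr (_ * _); apply: eq_bigr => k _.
  rewrite /monic_norm mulrC divfK // expf_neq0 //.
  by rewrite cheb_unit_neq0 // (leq_trans (ltn_ord k)).
rewrite -e mulr_sumr [LHS](bigID (fun X : {set 'I_P} => l \in X)) /=.
rewrite [X in X + _]big1 ?add0r => [|X /andP[_ lX]]; last first.
  by rewrite (bigD1 l) //= eqxx !mul0r.
apply: eq_bigr => X /andP[/eqP cX lX].
rewrite big1 => [|x xX]; last by case: eqVneq xX lX => // -> ->.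
by rewrite mul1r set_det_cheb cX exprMn -prodrXl.
Qed.

Lemma cheb_unitS P k : (k.+1 < P)%N ->
  (P%:R - 1 - k%:R) * cheb_unit P k.+1 = - (2 * (2 * k%:R + 1)) * cheb_unit P k.
Proof.
move=> kP; rewrite /cheb_unit factS ffactnSr !natrM.
have e := cheb_coef_up R k k; have k1 := natS_neq0 R k.
have d := natB1_neq0 R kP.
have -> : (P - 1 - k)%:R = P%:R - 1 - k%:R :> R by rewrite !natrB //; lia.
have f0 : ((P - 1) ^_ k)%:R != 0 :> R by rewrite pnatr_eq0 -lt0n ffact_gt0; lia.
have -> : cheb_coef R k.+1 k.+1
  = - ((k%:R + 2 + k%:R) * (k%:R + 1 + k%:R)) * cheb_coef R k k / (k%:R + 1) ^+ 2.
  by rewrite -e mulrAC divff ?mul1r // expf_neq0.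
rewrite -(natr1 k); field; by rewrite f0 d k1.
Qed.

Lemma monic_norm0 P : monic_norm P 0 = P%:R.
Proof. by rewrite /monic_norm cheb_norm0 /cheb_unit cheb_coef0 fact0 ffactn0 !mul1r
  invr1 expr1n divr1. Qed.

Lemma monic_normS P k : (k.+1 < P)%N ->
  4 * (2 * k%:R + 1) * (2 * k%:R + 3) * monic_norm P k.+1
  = (P%:R + k%:R + 1) * (P%:R - 1 - k%:R) * monic_norm P k.
Proof.
move=> kP; rewrite /monic_norm.
have e1 := cheb_normS R kP; have e2 := cheb_unitS kP.
have d := natB1_neq0 R kP; have k0 : 0 <= k%:R :> R := ler0n _ _.
have c1 : 2 * k%:R + 1 != 0 :> R by apply: lt0r_neq0; lra.
have c3 : 2 * k%:R + 3 != 0 :> R by apply: lt0r_neq0; lra.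
have u0 := cheb_unit_neq0 (ltnW kP).
have -> : cheb_unit P k.+1 = - (2 * (2 * k%:R + 1)) * cheb_unit P k / (P%:R - 1 - k%:R).
  by rewrite -e2 mulrAC divff ?mul1r.
have -> : cheb_dot R P k.+1 k.+1 = (2 * k%:R + 1) * (P%:R + k%:R + 1) * cheb_dot R P k k
    / ((2 * k%:R + 3) * (P%:R - 1 - k%:R)).
  by rewrite -e1; field; rewrite c3 d.
field; nz.
Qed.

Lemma monic_norm_shift P k : (k < P)%N ->
  (P%:R - k%:R) * monic_norm P.+1 k = (P%:R + 1 + k%:R) * monic_norm P k.
Proof.
elim: k => [|k IH] kP; first by rewrite !monic_norm0 -natr1; ring.
have k0 : 0 <= k%:R :> R := ler0n _ _.
have c : 4 * (2 * k%:R + 1) * (2 * k%:R + 3) != 0 :> R by apply: lt0r_neq0; nra.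
have e1 := monic_normS (ltnW kP : k.+1 < P.+1)%N; have e2 := monic_normS kP.
apply: (mulfI c); rewrite mulrCA e1 [RHS]mulrCA e2 -(natr1 P) -(natr1 k).
have := IH (ltnW kP) => e.
apply: (eq_comb1 (c := (P%:R + 1 + k%:R + 1) * (P%:R - (k%:R + 1))) e); ring.
Qed.

Lemma set_det_setT N : set_det (bin_fun (P:=N)) [set: 'I_N] = 1.
Proof.
have cN : #|[set: 'I_N]| = N by rewrite cardsT card_ord.
have ev (j : 'I_#|[set: 'I_N]|) : enum_val j = j :> nat.
  have x0 : 'I_N := cast_ord cN j.
  rewrite (enum_val_nth x0) (_ : enum [set: 'I_N] = enum 'I_N); last first.
    by apply: eq_enum => x; rewrite inE.
  by rewrite nth_enum_ord // -[X in (_ < X)%N]cN.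
rewrite /set_det det_trig; last first.
  by apply/is_trig_mxP => i j ij; rewrite mxE /bin_fun bin_small // ev.
by rewrite big1 // => i _; rewrite mxE /bin_fun ev binn.
Qed.

(* For M = 0 the only set of size N is {0, ..., N - 1}, whose determinant is 1. *)
Lemma prod_monic_norm_diag N : \prod_(k < N) monic_norm N k = 1.
Proof.
rewrite -sum_sqr_set_det // (big_pred1 [set: 'I_N]) ?set_det_setT ?expr1n // => X.
rewrite /= eqEcard subsetT cardsT card_ord /= eqn_leq.
by rewrite -[X in (_ <= X)%N && _]card_ord max_card.
Qed.

Lemma prod_succ_ratio (a N : nat) : (0 < a)%N ->
  \prod_(1 <= k < N.+1) (((a + 1 + k)%:R - 1) / ((a + 1 + k)%:R - 2))
    = (a + N)%:R / a%:R :> R.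
Proof.
move=> a0; have an : a%:R != 0 :> R by rewrite pnatr_eq0; lia.
elim: N => [|N IH]; first by rewrite big_geq // addn0 divff.
rewrite big_nat_recr //= IH.
have aN : (a + N)%:R != 0 :> R by rewrite pnatr_eq0; lia.
have -> : (a + 1 + N.+1)%:R - 1 = (a + N.+1)%:R :> R by rewrite addnAC natrD addrK.
have -> : (a + 1 + N.+1)%:R - 2 = (a + N)%:R :> R.
  by rewrite (_ : a + 1 + N.+1 = a + N + 2)%N ?natrD ?addrK //; lia.
by rewrite mulrC mulrA divfK.
Qed.

(** Adding the layer j = M + 1 multiplies the triple product by a factor that telescopes in k
    ([prod_succ_ratio]), and the norms by the ratios in [monic_norm_shift]. *)
Lemma macmahon_norm N M :
  \prod_(1 <= i < N.+1) \prod_(1 <= j < M.+1) \prod_(1 <= k < N.+1)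
      (((i + j + k)%:R - 1) / ((i + j + k)%:R - 2))
  = \prod_(k < N) monic_norm (N + M) k.
Proof.
elim: M => [|M IH].
  by rewrite addn0 prod_monic_norm_diag big1 // => i _; rewrite big_geq.
under eq_bigr => i _ do rewrite big_nat_recr //=.
rewrite big_split /= IH addnS.
have -> : \prod_(1 <= i < N.+1) \prod_(1 <= k < N.+1)
   (((i + M.+1 + k)%:R - 1) / ((i + M.+1 + k)%:R - 2)) =
   \prod_(k < N) ((N + M + 1 + k)%:R / (N + M - k)%:R) :> R.
  rewrite big_add1 /= big_mkord.
  transitivity (\prod_(i < N) ((i.+1 + M + N)%:R / (i.+1 + M)%:R) : R).
    by apply: eq_bigr => i _; rewrite -(prod_succ_ratio N) // -?addnA ?addn1.
  rewrite !big_split /= ; congr (_ * _).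
    by apply: eq_bigr => i _; congr (_%:R); lia.
  rewrite (reindex_inj rev_ord_inj); apply: eq_bigr => i _ /=.
  by congr (_%:R^-1); have := ltn_ord i; lia.
rewrite -big_split; apply: eq_bigr => k _ /=.
have kP : (k < N + M)%N by have := ltn_ord k; lia.
have e := monic_norm_shift kP.
have d : (N + M)%:R - k%:R != 0 :> R by rewrite nat_neq //; lia.
have -> : (N + M + 1 + k)%:R = (N + M)%:R + 1 + k%:R :> R by rewrite !natrD.
by apply: (mulfI d); rewrite e (natrB _ (ltnW kP)) [_ * (_ / _)]mulrA mulrC divfK //
  mulrC.
Qed.

End Center.

(** * Counting interlacing chains by binomial determinants *)

Section GelfandTsetlin.
Variable R : realType.
Implicit Types (k : nat) (s : seq nat).

Definition bin_det k s : R := \det (\matrix_(i < k, j < k) 'C(nth 0%N s i, j)%:R).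

Lemma set_det_bin P (X : {set 'I_P}) k : #|X| = k ->
  set_det (@bin_fun R P) X = bin_det k (positions X).
Proof.
move=> <-; rewrite /set_det /bin_det; congr (\det _); apply/matrixP => i j.
rewrite !mxE /bin_fun /positions (nth_map (enum_val i)) -?cardE ?ltn_ord //.
by rewrite -enum_val_nth.
Qed.

(** Subtracting from each row the preceding one, which is multiplication by the unitriangular [L],
    leaves 1, 0, ..., 0 in the column j = 0. *)
Lemma bin_detS k s : bin_det k.+1 s =
  \det (\matrix_(i < k, j < k) ('C(nth 0%N s i.+1, j.+1)%:R - 'C(nth 0%N s i,
    j.+1)%:R : R)).
Proof.
rewrite /bin_det; set A := \matrix_(i < k.+1, j < k.+1) _.
pose L : 'M[R]_k.+1 := \matrix_(i, j) ((i == j)%:R - (i == j.+1 :> nat)%:R).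
have dL : \det L = 1.
  rewrite det_trig ?big1 // => [i _|].
    by rewrite mxE eqxx [i == i.+1 :> nat]ltn_eqF // subr0.
  apply/is_trig_mxP => i j ij; rewrite mxE -val_eqE /= !ltn_eqF ?subrr //.
  exact: ltnW.
pose B : 'M[R]_k.+1 := \matrix_(i, j)
  ('C(nth 0%N s i, j)%:R - (if val i is i'.+1 then 'C(nth 0%N s i', j)%:R else 0)).
have LA : L *m A = B.
  apply/matrixP => i j; rewrite !mxE.
  rewrite (eq_bigr (fun l => (i == l)%:R * A l j - (i == l.+1 :> nat)%:R * A l j)) =>
    [|l _]; last first.
    by rewrite mxE mulrBl.
  rewrite sumrB; congr (_ - _).
    rewrite (bigD1 i) //= eqxx mul1r mxE big1 ?addr0 // => l li.
    by rewrite eq_sym (negPf li) mul0r.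
  case: i => [[|i] ik] /=; first by rewrite big1 // => l _; rewrite mul0r.
  rewrite (bigD1 (Ordinal (ltnW ik))) //= eqxx mul1r mxE big1 ?addr0 // => l li.
  by rewrite eqSS eq_sym -[i]/(val (Ordinal (ltnW ik))) val_eqE (negPf li) mul0r.
have -> : \det A = \det (L *m A) by rewrite det_mulmx dL mul1r.
rewrite LA (expand_det_col B ord0) big_ord_recl.
rewrite mxE /= bin0 subr0 mul1r big1 ?addr0 => [|i _]; last first.
  by rewrite mxE /= !bin0 subrr mul0r.
rewrite /cofactor addn0 expr0 mul1r; congr (\det _).
by apply/matrixP => i j; rewrite !mxE.
Qed.

(** Pascal's rule summed from a to b. *)
Lemma bin_sub_sum P a b j : (a <= b <= P)%N ->
  'C(b, j.+1)%:R - 'C(a, j.+1)%:R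
  = \sum_(y : 'I_P) (a <= y < b)%:R * 'C(y, j)%:R :> R.
Proof.
move=> /andP[ab bP].
have -> : \sum_(y : 'I_P) (a <= y < b)%:R * 'C(y, j)%:R
        = \sum_(a <= y < b) 'C(y, j)%:R :> R.
  rewrite big_geq_mkord (big_ord_widen_cond _ _ (fun y => 'C(y, j)%:R : R) bP).
  rewrite big_mkcond [RHS]big_mkcond; apply: eq_bigr => y _.
  by rewrite /=; case: (_ && _); rewrite ?mul1r ?mul0r.
apply/eqP; rewrite subr_eq addrC; apply/eqP.
elim: b ab bP => [|b IH] ab bP.
  by move: ab; rewrite leqn0 => /eqP ->; rewrite big_geq // addr0.
move: ab; rewrite leq_eqVlt => /predU1P[->|ab]; first by rewrite big_geq // addr0.
by rewrite big_nat_recr //= addrA -IH ?(ltnW bP) // binS natrD.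
Qed.

(** Row i of the matrix in [bin_detS] is the sum over y in [x_i, x_(i+1)) of the rows binomial(y,
    j). Multilinearity yields one determinant for each choice of the y_i, that is, for each
    interlacing Y. *)
Lemma sum_interlaces P (X : {set 'I_P}) k : #|X| = k.+1 ->
  \sum_(Y : {set 'I_P} | interlaces X Y) set_det (@bin_fun R P) Y
  = set_det (@bin_fun R P) X.
Proof.
move=> cX; rewrite (set_det_bin cX) bin_detS.
set s := positions X; have ss : size s = k.+1 by rewrite size_positions.
have sP i : (i < k.+1)%N -> (nth 0%N s i < P)%N.
  move=> ik; have : nth 0%N s i \in s by rewrite mem_nth // ss.
  by case/mapP => x _ ->; apply: ltn_ord.
have smono i : (i < k)%N -> (nth 0%N s i < nth 0%N s i.+1)%N.
  move=> ik; have := positions_sorted X => /(sortedP 0%N); apply.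
  by rewrite -/s ss.
have x0 : 'I_P := Ordinal (sP 0%N isT).
pose ok (f : {ffun 'I_k -> 'I_P}) := [forall i : 'I_k,
  (nth 0%N s i <= f i < nth 0%N s i.+1)%N].
transitivity (\sum_(f : {ffun 'I_k -> 'I_P} | ok f) \det (eval_mx (@bin_fun R P) f));
  last first.
  have -> : \matrix_(i < k, j < k) ('C(nth 0%N s i.+1, j.+1)%:R - 'C(nth 0%N s i,
    j.+1)%:R : R)
     = \matrix_(i < k, j < k) \sum_(y : 'I_P) (nth 0%N s i <= y < nth 0%N s i.+1)%:R *
       'C(y, j)%:R.
    apply/matrixP => i j; rewrite !mxE (@bin_sub_sum P) //.
    by rewrite (ltnW (smono _ _)) //= ltnW // sP // ltnS ltn_ord.
  rewrite (det_sum_rows (fun (i : 'I_k) (y : 'I_P) =>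
    (nth 0%N s i <= y < nth 0%N s i.+1)%:R)
              (fun (_ : 'I_k) (y : 'I_P) (j : 'I_k) => 'C(y, j)%:R)).
  rewrite [LHS]big_mkcond; apply: eq_bigr => f _.
  case: ifPn => [/forallP okf|]; first by rewrite big1 ?mul1r // => i _; rewrite okf.
  rewrite negb_forall => /existsP[i /negPf bad].
  by rewrite (bigD1 i) //= bad !mul0r.
(* [h] lists Y in increasing order and [h'] takes the image. They are inverse to each other because
   the intervals are disjoint and increasing, which makes an admissible f strictly increasing. *)
pose h (Y : {set 'I_P}) := [ffun i : 'I_k => nth x0 (enum Y) i].
pose h' (f : {ffun 'I_k -> 'I_P}) := [set f i | i : 'I_k].
have okmono f : ok f -> forall i j : 'I_k, (i < j)%N -> (f i < f j)%N.
  move=> /forallP okf i j ij; have /andP[_ a1] := okf i; have /andP[a2 _] := okf j.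
  apply: leq_trans a1 (leq_trans _ a2).
  have : sorted leq s.
    by apply: sub_sorted (positions_sorted X) => ? ? /ltnW.
  move=> /(sorted_leq_nth leq_trans leqnn 0%N); apply => //; rewrite inE ss ltnS.
    exact: ltn_ord.
  exact/ltnW/ltn_ord.
have okinj f : ok f -> injective f.
  move=> /okmono m i j fij; apply: val_inj; apply/eqP; case: ltngtP => // /m.
    by rewrite fij ltnn.
  by rewrite fij ltnn.
have pos_h' f : ok f -> positions (h' f) = [seq val (f i) | i <- enum 'I_k].
  move=> okf; apply: (irr_sorted_eq ltn_trans ltnn) (positions_sorted _) _ _.
    rewrite sorted_map.
    have : sorted ltn (map val (enum 'I_k)) by rewrite val_enum_ord iota_ltn_sorted.
    by rewrite sorted_map; apply: sub_sorted => i j; exact: okmono.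
  move=> e; rewrite mem_positions;
    apply/existsP/mapP => [[x /andP[/imsetP[i _ ->] /eqP <-]]|[i _ ->]].
    by exists i; rewrite ?mem_enum.
  by exists (f i); rewrite eqxx andbT imset_f.
have card_h' f : ok f -> #|h' f| = k.
  by move=> okf; rewrite card_imset ?card_ord //; exact: okinj.
have pos_h (Y : {set 'I_P}) (i : 'I_k) : #|Y| = k -> nth 0%N (positions Y) i = h Y i.
  by move=> cY; rewrite ffunE (nth_map x0) // -cardE cY.
rewrite [RHS](reindex_onto h h') => [|f okf]; last first.
  apply/ffunP => i; apply: val_inj; rewrite /= -(pos_h _ i (card_h' _ okf)) pos_h' //.
  by rewrite (nth_map i) ?size_enum_ord // nth_ord_enum.
apply: eq_big => [Y|Y]; last first.
  rewrite /interlaces cX eqSS => /andP[/eqP cY _].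
  rewrite (set_det_bin (esym cY)) /bin_det; congr (\det _); apply/matrixP => i j.
  by rewrite !mxE /bin_fun pos_h.
apply/idP/andP => [iY|[okh /eqP hY]].
  have cY : #|Y| = k by move: iY => /andP[]; rewrite cX eqSS => /eqP.
  split.
    by apply/forallP => i; rewrite -pos_h //; exact: (elimT (interlacesP cX cY) iY).
  rewrite eqEcard; apply/andP; split.
    apply/subsetP => _ /imsetP[i _ ->]; rewrite ffunE -mem_enum mem_nth // -cardE cY //.
  rewrite cY card_in_imset ?card_ord // => i j _ _; rewrite !ffunE => /eqP.
  by rewrite nth_uniq ?enum_uniq -?cardE ?cY // => /eqP/val_inj.
have cY : #|Y| = k by rewrite -hY card_h'.
apply/(interlacesP cX cY) => i ik; rewrite (pos_h Y (Ordinal ik)) //.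
by move/forallP: okh => /(_ (Ordinal ik)).
Qed.

Lemma card_chains P k (X : {set 'I_P}) : #|X| = k ->
  #|[set p : k.-tuple {set 'I_P} | path (@interlaces P) X p]|%:R
  = set_det (@bin_fun R P) X.
Proof.
elim: k X => [|k IH] X cX.
  rewrite (set_det_bin cX) /bin_det det_mx00 (_ : [set _ | _] = setT).
    by rewrite cardsT card_tuple expn0.
  by apply/setP => p; rewrite !inE tuple0.
rewrite -(sum_interlaces cX) -sum1_card natr_sum.
rewrite (reindex (fun z : {set 'I_P} * k.-tuple {set 'I_P} =>
  [tuple of z.1 :: z.2])) /=; last first.
  exists (fun p : k.+1.-tuple {set 'I_P} => (thead p, [tuple of behead p])) =>
    [[Y p]|p] _ /=.
    by rewrite theadE; congr (_, _); apply: val_inj.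
  by rewrite -tuple_eta.
rewrite (eq_bigl (fun z : {set 'I_P} * k.-tuple {set 'I_P} =>
  interlaces X z.1 && path (@interlaces P) z.1 z.2)); last first.
  by move=> z; rewrite inE.
rewrite -(pair_big_dep (fun Y => interlaces X Y) (fun Y (p : k.-tuple _) =>
  path (@interlaces P) Y p) (fun _ _ => 1)) /=.
apply: eq_bigr => Y iY; rewrite -IH; last by move: iY => /andP[]; rewrite cX eqSS => /eqP.
by rewrite -sum1_card natr_sum; apply: eq_bigl => p; rewrite inE.
Qed.

End GelfandTsetlin.

(** * The singular parenthesis *)

From mathcomp Require Import all_classical all_reals all_analysis.
Import numFieldNormedType.Exports.

(** Proves convergence of a polynomial expression by its shape; the arguments are the closure lemmas
    for constants, identity, sums, opposites, products and powers. *)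
Ltac poly_cvg Cc Ci CD CN CM CX := repeat lazymatch goal with
  | |- _ (fun _ => ?a) => exact (Cc a)
  | |- _ (fun x => x) => exact Ci
  | |- _ (fun x => @?f x + @?g x) => apply (CD f g)
  | |- _ (fun x => @?f x * @?g x) => apply (CM f g)
  | |- _ (fun x => - @?f x) => apply (CN f)
  | |- _ (fun x => @?f x ^+ ?k) => apply (CX f k)
  end.

Section Parenthesis.
Variable R : realType.
Implicit Types (n m k h : nat).
Local Notation hyp_coef := (hyp_coef R).
Local Notation center_kernel := (center_kernel R).
Local Notation mid_weight := (mid_weight R).
Local Notation kernel_scale := (kernel_scale R).
Local Notation kernel_sum := (kernel_sum R).

(* (2 - n - x)_h / (3 - n - x)_h = (2 - n - x) / (2 - n - x + h), and its product with
   (x - 1) / (n + x - 2) is (x - 1) / (n + x - 2 - h) up to sign, which is constant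
   for h = n - 1. *)
Definition regular_parenthesis n (x : R) : R := let nu : R := n%:R in
  (nu + 2) * (nu + 3) * (2 * nu - 1) * (2 * nu - 3) * Ypoly x nu
    / ((nu + x - 1) * (nu + x) ^+ 2 * (nu + x + 1))
  - 24 * nu * (2 * nu + x + 1) * (2 * nu + 3)
    * \sum_(h < n) (if h.+1 == n then 1 else (x - 1) / (nu + x - 2 - h%:R))
        * hyp_coef n h / (nu + x + 2 + h%:R).

Lemma shifted_factorial_shift (a : R) k :
  shifted_factorial (a + 1) k * a = shifted_factorial a k * (a + k%:R).
Proof.
elim: k => [|k IH]; first by rewrite /shifted_factorial !big_geq // addr0 !mul1r.
rewrite /shifted_factorial !big_nat_recr //= -!/(shifted_factorial _ _) -(natr1 k).
rewrite mulrAC IH; ring.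
Qed.

Lemma shifted_factorial_ratio (a : R) k : shifted_factorial (a + 1) k != 0 ->
  a + k%:R != 0 ->
  shifted_factorial a k / shifted_factorial (a + 1) k = a / (a + k%:R).
Proof.
move=> h1 h2; have := shifted_factorial_shift a k => e.
by apply/eqP; rewrite eqr_div // -e mulrC.
Qed.

Lemma shifted_factorial_neq0 (a : R) k :
  (forall i, (i < k)%N -> a + i%:R != 0) -> shifted_factorial a k != 0.
Proof.
move=> H; rewrite /shifted_factorial big_mkord; apply/prodf_neq0 => i _.
exact: H.
Qed.

Lemma parenthesis_regular n (x : R) : (0 < n)%N -> 0 < x -> x != 1 ->
  parenthesis n x = regular_parenthesis n x.
Proof.
move=> n0 x0 x1; rewrite /parenthesis /regular_parenthesis /=; congr (_ - _).
have n1 : 1 <= n%:R :> R by rewrite ler1n.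
(* For i <= n - 2 this is at least x > 0; for i = n - 1 it is x - 1. *)
have pole i : (i < n)%N -> n%:R + x - 2 - i%:R != 0.
  rewrite leq_eqVlt => /predU1P[E|E].
    by apply: (contra_neq _ x1) => e; move: e; rewrite -E -natr1; lra.
  have : i%:R + 2 <= n%:R :> R by rewrite -natrD ler_nat addn2.
  move=> ?; apply: lt0r_neq0; lra.
rewrite /hypergeometric_sum big_mkord /= !mulr_sumr; apply: eq_bigr => h _.
have hn := ltn_ord h; have h0 : 0 <= h%:R :> R := ler0n _ _.
have p0 := pole 0%N n0; have ph := pole h hn.
have e1 := @shifted_factorial_ratio (2 + n%:R + x) h.
have e2 := @shifted_factorial_ratio (2 - n%:R - x) h.
rewrite (_ : 2 + n%:R + x + 1 = 3 + n%:R + x) in e1; last by ring.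
rewrite (_ : 2 - n%:R - x + 1 = 3 - n%:R - x) in e2; last by ring.
have c2 : 2 - n%:R - x + h%:R != 0 by apply: (contra_neq _ ph) => ?; lra.
have {}e1 : shifted_factorial (2 + n%:R + x) h / shifted_factorial (3 + n%:R + x) h
   = (2 + n%:R + x) / (2 + n%:R + x + h%:R).
  apply: e1; last by apply: lt0r_neq0; lra.
  by apply: shifted_factorial_neq0 => i _; have := ler0n R i => i0;
    apply: lt0r_neq0; lra.
have {}e2 : shifted_factorial (2 - n%:R - x) h / shifted_factorial (3 - n%:R - x) h
   = (2 - n%:R - x) / (2 - n%:R - x + h%:R).
  apply: e2 => //; apply: shifted_factorial_neq0 => i ih.
  have /pole : (i.+1 < n)%N by lia.
  by rewrite -natr1 => p; apply: (contra_neq _ p) => ?; lra.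
have -> : shifted_factorial 4 h * shifted_factorial (1 - n%:R) h *
 shifted_factorial (5 / 2 + n%:R) h * shifted_factorial (2 - n%:R - x) h *
 shifted_factorial (2 + n%:R + x) h /
 (shifted_factorial 1 h * shifted_factorial (4 + n%:R) h *
  shifted_factorial (5 / 2 - n%:R) h * shifted_factorial (3 + n%:R + x) h *
  shifted_factorial (3 - n%:R - x) h) = hyp_coef n h *
  (shifted_factorial (2 + n%:R + x) h / shifted_factorial (3 + n%:R + x) h) *
  (shifted_factorial (2 - n%:R - x) h / shifted_factorial (3 - n%:R - x) h).
  have -> : hyp_coef n h = shifted_factorial 4 h * shifted_factorial (1 - n%:R) h
    * shifted_factorial (5 / 2 + n%:R) h / (shifted_factorial 1 h
    * shifted_factorial (4 + n%:R) h * shifted_factorial (5 / 2 - n%:R) h) by [].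
  by rewrite !invfM; ring.
rewrite e1 e2.
have -> : (if h.+1 == n then 1 else (x - 1) / (n%:R + x - 2 - h%:R))
          = (x - 1) / (n%:R + x - 2 - h%:R).
  case: eqP => // E; have E' : h%:R + 1 = n%:R :> R by rewrite natr1 E.
  by rewrite (_ : n%:R + x - 2 - h%:R = x - 1) ?divff ?subr_eq0 //; lra.
have p0' : n%:R + x - 2 != 0 by rewrite -[X in X != 0]subr0.
have c1 : n%:R + x + 2 + h%:R != 0 by apply: lt0r_neq0; lra.
have c3 : n%:R + x + 2 != 0 by apply: lt0r_neq0; lra.
have c4 : 2 + n%:R + x + h%:R != 0 by apply: lt0r_neq0; lra.
by field; nz.
Qed.

(** At x = 1 the only denominator that would vanish belongs to h = n - 1, where the quotient has
    been replaced by 1; so the limit is the value. *)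
Lemma cvg_regular_parenthesis n : (0 < n)%N ->
  (regular_parenthesis n x @[x --> (1 : R)^'] --> regular_parenthesis n 1)%classic.
Proof.
move=> n0; pose C (f : R -> R) := (f x @[x --> (1 : R)^'] --> f 1)%classic.
have Cc a : C (fun=> a) by exact: cvg_cst.
have Ci : C id by exact: nbhs_dnbhs.
have CD f g : C f -> C g -> C (fun x => f x + g x) by move=> *; exact: cvgD.
have CN f : C f -> C (fun x => - f x) by move=> *; exact: cvgN.
have CM f g : C f -> C g -> C (fun x => f x * g x) by move=> *; exact: cvgM.
have CX f k : C f -> C (fun x => f x ^+ k).
  move=> Cf; elim: k => [|k IH]; first exact: (Cc).
  by rewrite (_ : (fun _ => _) = (fun x => f x * f x ^+ k)) ?funeqE //;
    [exact: (CM) | move=> x; rewrite exprS].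
have CV f : f 1 != 0 -> C f -> C (fun x => (f x)^-1) by move=> *; exact: cvgV.
have CS (m : nat) (f : nat -> R -> R) : (forall h, (h < m)%N -> C (f h)) ->
  C (fun x => \sum_(h < m) f h x).
  elim: m => [|m IH] H.
    by rewrite (_ : (fun _ => _) = (fun=> 0)) ?funeqE // => x; rewrite big_ord0.
  rewrite (_ : (fun _ => _) = (fun x => \sum_(h < m) f h x + f m x)) ?funeqE;
    last by move=> x; rewrite big_ord_recr.
  by apply: (CD); [apply: IH => h hm; apply: H; exact: ltnW | exact: H].
have n1 : 1 <= n%:R :> R by rewrite ler1n.
rewrite -/(C (regular_parenthesis n)) /regular_parenthesis /Ypoly.
pose T h (x : R) := (if h.+1 == n then 1 else (x - 1) / (n%:R + x - 2 - h%:R))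
  * hyp_coef n h / (n%:R + x + 2 + h%:R).
apply: (CD); [apply: (CM) | apply: (CN); apply: (CM); last apply: (CS n T)].
- by poly_cvg Cc Ci CD CN CM CX.
- apply: (CV); first by rewrite !mulf_neq0 ?expf_neq0 //; apply: lt0r_neq0; lra.
  by poly_cvg Cc Ci CD CN CM CX.
- by poly_cvg Cc Ci CD CN CM CX.
- move=> h hn; rewrite /T; have h0 : 0 <= h%:R :> R := ler0n _ _.
  apply: (CM); last first.
    apply: (CV); first by apply: lt0r_neq0; lra.
    by poly_cvg Cc Ci CD CN CM CX.
  apply: (CM); last exact: (Cc).
  case: eqP => // E; apply: (CM).
    by poly_cvg Cc Ci CD CN CM CX.
  apply: (CV); last by poly_cvg Cc Ci CD CN CM CX.
  rewrite (_ : n%:R + 1 - 2 - h%:R = n%:R - h.+1%:R); last by rewrite -natr1; ring.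
  by rewrite subr_eq0 eqr_nat; apply/eqP => ?; apply: E.
Qed.

Lemma parenthesis_value_regular n m : (0 < n)%N -> (0 < m)%N ->
  parenthesis_value n m (regular_parenthesis n m%:R).
Proof.
move=> n0 m0; rewrite /parenthesis_value; case: eqP => [->|/eqP m1]; last first.
  by rewrite parenthesis_regular ?ltr0n // pnatr_eq1.
apply: cvg_trans (cvg_regular_parenthesis n0).
apply: near_eq_cvg; near=> x; apply/esym/parenthesis_regular => //.
  near: x; apply: nbhs_dnbhs; exact: lt_nbhsr.
by near: x; exact: nbhs_dnbhs_neq.
Unshelve. all: by end_near.
Qed.

(** The denominator (s - 1) s^2 (s + 1) below Y, with s = n + m, combines with [prefactorE] into
    (s^2 - 1)^2, and both terms become those of [center_kernelE]. *)
Lemma prefactor_parenthesis n m : (0 < n)%N -> (0 < m)%N ->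
  prefactor R n m * regular_parenthesis n m%:R = center_kernel (n + m) (2 * n).+1.
Proof.
move=> n0 m0; rewrite center_kernelE //; last by lia.
rewrite [prefactor _ _ _](prefactorE R n0 m0) /kernel_scale.
have -> : kernel_sum (n + m) n = \sum_(h < n) (if h.+1 == n then 1
   else (m%:R - 1) / (n%:R + m%:R - 2 - h%:R)) * hyp_coef n h / (n%:R + m%:R + 2 + h%:R).
  apply: eq_bigr => h _.
  by rewrite (_ : (n + m)%:R - n%:R - 1 = m%:R - 1) natrD //; ring.
rewrite /regular_parenthesis /=; set S := \sum_(_ < _) _.
have -> : (n + m)%:R - n%:R = m%:R :> R by rewrite natrD; ring.
rewrite -!/(Ypoly _ _).
have n1 : 1 <= n%:R :> R by rewrite ler1n.
have m1 : 1 <= m%:R :> R by rewrite ler1n.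
have d1 : (n%:R + m%:R) ^+ 2 - 1 != 0 :> R by rewrite -natrD sqB1_neq0 //; lia.
have d3 := even_neq_odd R n 1.
rewrite natrD; move: (Ypoly _ _) (mid_weight _ _) S => Y W S; by field; nz.
Qed.

End Parenthesis.

Theorem theorem6 (R : realType) (n m : nat) (n_gt0 : (0 < n)%N)
    (m_gt0 : (0 < m)%N) :
  exists L : R,
    parenthesis_value n m L /\
    (num_tilings_containing (2 * n + 1) (2 * m - 1) (n + m + 1))%:R
      = prefactor R n m * L * macmahon_product R n m.
Proof.
exists (regular_parenthesis n m%:R).
split; first exact: parenthesis_value_regular.
(* So s = n + m and l = s + 1, and the 2 n + 1 holes on the axis correspond to the degrees below 2 n
   + 1 in [center_kernel]. *)
have hP : (2 * n + 1 + (2 * m - 1) = 2 * (n + m))%N by lia.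
have lP : (n + m + 1 < 2 * n + 1 + (2 * m - 1))%N by lia.
rewrite -[(n + m + 1)%N]/(nat_of_ord (Ordinal lP)) num_tilings_chains card_good_chains.
rewrite natr_sum (eq_bigr (fun X => set_det (@bin_fun R _) X ^+ 2)) =>
  [|X /andP[/eqP cX _]]; last first.
  by rewrite natrX (card_chains R cX).
rewrite sum_sqr_set_det_mem ?leq_addr // -macmahon_norm mulrC; congr (_ * _).
by rewrite prefactor_parenthesis // /center_kernel /= hP !addn1.
Qed.
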